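(* There exist an absolute constant $c>0$ and, for each $K>0$, a constant $C_K>0$ depending only on $K$, such that the following holds. Let $\mathbf{A}\in\mathbb{Q}^{N\times n}$ with $N>4n$ be a random quaternion matrix whose rows $\mathbf{A}_i$ ($i=1,\dots,N$) are independent quaternion sub-Gaussian isotropic vectors, and let $K=\max_i\|\mathbf{A}_i\|_{\psi_2}$. Then for every $t>0$, with probability at least $1-\exp(-ct^2/K^4)$, $$2\sqrt{N}-2C_K\sqrt{n}-2t\le\sigma_{\min}(\mathbf{A})\le\sigma_{\max}(\mathbf{A})\le2\sqrt{N}+2C_K\sqrt{n}+2t .$$
   Context: $\mathbb{Q}$ denotes the real quaternions; $\sigma_{\min}(\mathbf{A})$ and $\sigma_{\max}(\mathbf{A})$ are the smallest ($n$-th) and largest singular values of $\mathbf{A}$. A real random variable $\xi$ is sub-Gaussian if $\mathbb{P}\{|\xi|>t\}\le\exp(1-ct^2)$ for all $t>0$ and some constant $c>0$; its sub-Gaussian norm is $\|\xi\|_{\psi_2}=\sup_{p\ge1}p^{-1/2}(\mathbb{E}|\xi|^p)^{1/p}$. For a quaternion random vector $\mathbf{v}=v_w+v_x\mathbf{i}+v_y\mathbf{j}+v_z\mathbf{k}$ with $n$ entries (row vectors being treated likewise), put $\mathbf{v}_r=[v_w^T,v_x^T,v_y^T,v_z^T]^T\in\mathbb{R}^{4n}$. $\mathbf{v}$ is sub-Gaussian if $\langle\mathbf{v}_r,x\rangle$ is a sub-Gaussian random variable for every $x\in\mathbb{R}^{4n}$; its sub-Gaussian norm is $\|\mathbf{v}\|_{\psi_2}=\sup_{x\in\mathbb{R}^{4n},\,x^Tx=1}\|\langle\mathbf{v}_r,x\rangle\|_{\psi_2}$.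 $\mathbf{v}$ is isotropic if $\mathbb{E}\,\mathbf{v}_r\mathbf{v}_r^T=I_{4n}$. *)

(* Defs.v *)
From HB Require Import structures.
From mathcomp Require Import all_boot all_order all_algebra.
From mathcomp Require Import ring.
From mathcomp Require Import all_classical all_reals all_analysis.
Set Implicit Arguments.
Unset Strict Implicit.
Unset Printing Implicit Defensive.
Import Order.TTheory GRing.Theory Num.Theory.
Import numFieldNormedType.Exports.
Local Open Scope classical_set_scope.
Local Open Scope ring_scope.

Record quat (R : Type) := Quat { qw : R; qx : R; qy : R; qz : R }.

Definition tuple_of_quat (R : Type) (q : quat R) : R * R * R * R :=
  (qw q, qx q, qy q, qz q).
Definition quat_of_tuple (R : Type) (p : R * R * R * R) : quat R :=
  let: (w, x, y, z) := p in Quat w x y z.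
Lemma tuple_of_quatK (R : Type) :
  cancel (@tuple_of_quat R) (@quat_of_tuple R).
Proof. by case. Qed.

HB.instance Definition _ (R : eqType) :=
  Equality.copy (quat R) (can_type (@tuple_of_quatK R)).
HB.instance Definition _ (R : choiceType) :=
  Choice.copy (quat R) (can_type (@tuple_of_quatK R)).

Definition qzero (R : nmodType) : quat R := Quat 0 0 0 0.
Definition qopp (R : zmodType) (a : quat R) : quat R :=
  Quat (- qw a) (- qx a) (- qy a) (- qz a).
Definition qadd (R : nmodType) (a b : quat R) : quat R :=
  Quat (qw a + qw b) (qx a + qx b) (qy a + qy b) (qz a + qz b).

Lemma qaddA (R : nmodType) : associative (@qadd R).
Proof. by move=> a b c; rewrite /qadd /= !addrA. Qed.
Lemma qaddC (R : nmodType) : commutative (@qadd R).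
Proof. by move=> a b; congr Quat; rewrite addrC. Qed.
Lemma qadd0 (R : nmodType) : left_id (@qzero R) (@qadd R).
Proof. by case=> w x y z; rewrite /qadd /= !add0r. Qed.
Lemma qaddN (R : zmodType) : left_inverse (@qzero R) (@qopp R) (@qadd R).
Proof. by move=> a; rewrite /qadd /= !addNr. Qed.

HB.instance Definition _ (R : zmodType) :=
  GRing.isZmodule.Build (quat R) (@qaddA R) (@qaddC R) (@qadd0 R) (@qaddN R).

Definition qone (R : comNzRingType) : quat R := Quat 1 0 0 0.
Definition qmul (R : comNzRingType) (a b : quat R) : quat R :=
  Quat (qw a * qw b - qx a * qx b - qy a * qy b - qz a * qz b)
       (qw a * qx b + qx a * qw b + qy a * qz b - qz a * qy b)
       (qw a * qy b - qx a * qz b + qy a * qw b + qz a * qx b)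
       (qw a * qz b + qx a * qy b - qy a * qx b + qz a * qw b).

Lemma qmulA (R : comNzRingType) : associative (@qmul R).
Proof. by move=> a b c; congr Quat => /=; ring. Qed.
Lemma qmul1q (R : comNzRingType) : left_id (@qone R) (@qmul R).
Proof. by case=> w x y z; congr Quat => /=; ring. Qed.
Lemma qmulq1 (R : comNzRingType) : right_id (@qone R) (@qmul R).
Proof. by case=> w x y z; congr Quat => /=; ring. Qed.
Lemma qmulDl (R : comNzRingType) : left_distributive (@qmul R) (@qadd R).
Proof. by move=> a b c; congr Quat => /=; ring. Qed.
Lemma qmulDr (R : comNzRingType) : right_distributive (@qmul R) (@qadd R).
Proof. by move=> a b c; congr Quat => /=; ring. Qed.
Lemma qone_neq0 (R : comNzRingType) : @qone R != 0.
Proof. by apply/eqP => -[] /eqP; rewrite oner_eq0. Qed.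

HB.instance Definition _ (R : comNzRingType) :=
  GRing.Zmodule_isNzRing.Build (quat R) (@qmulA R) (@qmul1q R) (@qmulq1 R)
    (@qmulDl R) (@qmulDr R) (@qone_neq0 R).

Definition qreal (R : comNzRingType) (r : R) : quat R := Quat r 0 0 0.
Definition qconj (R : comNzRingType) (a : quat R) : quat R :=
  Quat (qw a) (- qx a) (- qy a) (- qz a).

Definition qadjoint (R : comNzRingType) (m n : nat) (A : 'M[quat R]_(m, n)) :
    'M[quat R]_(n, m) :=
  (map_mx (@qconj R) A)^T.

Definition qunitary (R : comNzRingType) (n : nat) (U : 'M[quat R]_n) : Prop :=
  qadjoint U *m U = 1%:M /\ U *m qadjoint U = 1%:M.

(* [s] is read off a quaternion singular value decomposition U^* A V = Sigma;
   it has min(m, n) entries, in nonincreasing order, with multiplicities. *)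
Definition is_singular_values (R : realType) (m n : nat)
    (A : 'M[quat R]_(m, n)) (s : seq R) : Prop :=
  [/\ size s = minn m n,
      sorted (fun a b : R => b <= a) s,
      all (fun a : R => 0 <= a) s &
      exists (U : 'M[quat R]_m) (V : 'M[quat R]_n),
        [/\ qunitary U, qunitary V &
            qadjoint U *m A *m V =
            \matrix_(i < m, j < n)
              (if i == j :> nat then qreal s`_i else 0)]].

(* Every quaternion matrix has exactly one such list, so that the default
   value [::] is never used. *)
Definition singular_values (R : realType) (m n : nat)
    (A : 'M[quat R]_(m, n)) : seq R :=
  xget [::] [set s | is_singular_values A s].

Definition sigma_max (R : realType) (m n : nat) (A : 'M[quat R]_(m, n)) : R :=
  (singular_values A)`_0.

(* The n-th singular value; meaningful for 0 < n <= m. *)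
Definition sigma_min (R : realType) (m n : nat) (A : 'M[quat R]_(m, n)) : R :=
  (singular_values A)`_n.-1.

Definition realvec (R : Type) (n : nat) (v : 'rV[quat R]_n) :
    'cV[R]_(n + n + (n + n)) :=
  col_mx (col_mx (map_mx (@qw R) v)^T (map_mx (@qx R) v)^T)
         (col_mx (map_mx (@qy R) v)^T (map_mx (@qz R) v)^T).

Definition dotv (R : pzRingType) (m : nat) (u x : 'cV[R]_m) : R :=
  (u^T *m x) ord0 ord0.

Definition random_quat (d : measure_display) (T : measurableType d)
    (R : realType) (X : T -> quat R) : Prop :=
  [/\ measurable_fun [set: T] (fun w => qw (X w)),
      measurable_fun [set: T] (fun w => qx (X w)),
      measurable_fun [set: T] (fun w => qy (X w)) &
      measurable_fun [set: T] (fun w => qz (X w))].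

Definition random_qmatrix (d : measure_display) (T : measurableType d)
    (R : realType) (m n : nat) (A : T -> 'M[quat R]_(m, n)) : Prop :=
  forall i j, random_quat (fun w => A w i j).

(* Mutual independence of random vectors of R^m, tested on Borel sets. *)
Definition mutually_independent (d : measure_display) (T : measurableType d)
    (R : realType) (P : probability T R) (I : finType) (m : nat)
    (X : I -> T -> 'cV[R]_m) : Prop :=
  forall (J : {set I}) (B : I -> set 'cV[R]_m),
    (forall i, <<s (@open 'cV[R]_m) >> (B i)) ->
    P [set w | forall i, i \in J -> B i (X i w)] =
    (\prod_(i in J) P [set w | B i (X i w)])%E.

Definition independent_rows (d : measure_display) (T : measurableType d)
    (R : realType) (P : probability T R) (N n : nat)
    (A : T -> 'M[quat R]_(N, n)) : Prop :=
  mutually_independent P (fun (i : 'I_N) w => realvec (row i (A w))).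

Definition subgaussian (d : measure_display) (T : measurableType d)
    (R : realType) (P : probability T R) (xi : T -> R) : Prop :=
  exists c : R, 0 < c /\ forall t : R, 0 < t ->
    (P [set w | (t < `|xi w|)%R] <= (expR (1 - c * t ^+ 2))%:E)%E.

Definition psi2_norm (d : measure_display) (T : measurableType d)
    (R : realType) (P : probability T R) (xi : T -> R) : \bar R :=
  ereal_sup [set ((p `^ (- 2^-1))%:E *
                  poweR ('E_P[fun w => (`|xi w| `^ p)%R]) p^-1)%E
            | p in [set p : R | 1 <= p]].

Definition subgaussian_qvec (d : measure_display) (T : measurableType d)
    (R : realType) (P : probability T R) (n : nat)
    (v : T -> 'rV[quat R]_n) : Prop :=
  forall x : 'cV[R]_(n + n + (n + n)),
    subgaussian P (fun w => dotv (realvec (v w)) x).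

Definition psi2_norm_qvec (d : measure_display) (T : measurableType d)
    (R : realType) (P : probability T R) (n : nat)
    (v : T -> 'rV[quat R]_n) : \bar R :=
  ereal_sup [set psi2_norm P (fun w => dotv (realvec (v w)) x)
            | x in [set x : 'cV[R]_(n + n + (n + n)) | dotv x x = 1]].

Definition isotropic (d : measure_display) (T : measurableType d)
    (R : realType) (P : probability T R) (n : nat)
    (v : T -> 'rV[quat R]_n) : Prop :=
  forall k l : 'I_(n + n + (n + n)),
    ('E_P[fun w => ((realvec (v w) *m (realvec (v w))^T) k l)%R] =
     ((1%:M : 'M[R]_(n + n + (n + n))) k l)%:E)%E.

(* Main.v *)
(* A deterministic part reduces the claim to finitely many vectors. The largest
   singular value is a maximum over the compact unit sphere, and splitting off a
   maximizer by Householder reflections yields the quaternion singular value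
   decomposition; hence sigma_min and sigma_max are the extreme values of
   |A x| / |x|, and |A x|^2 is a real quadratic form in 4n variables, the sum over
   the rows of four squares <A_i, x e>^2 with e in {1, i, j, k}. If such a form
   deviates from 4N |y|^2 by at most eps N |y|^2 on the integer vectors y with
   |y|_1 <= 5 * 4n, it does so by at most 4 eps N |x|^2 everywhere; there are at
   most 2^(28 n) such y. The probabilistic part fixes y: E <A_i, x>^2 = 1 and the
   moment bounds E <A_i, x>^(2p) <= M^p p! with M = 2 e K^2 control the exponential
   moments of each row, independence multiplies them, and the Chernoff bound gives
   the failure probability 2 exp(-dl^2 N / (128 M^2)) for eps = max(dl, dl^2). With
   dl = (C sqrt n + t) / sqrt N and C large the C^2 n term absorbs the union bound. *)
Require Import Defs.
From mathcomp Require Import all_boot all_order all_algebra.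
From mathcomp Require Import ring lra zify.
From mathcomp Require Import all_classical all_reals all_analysis.
From mathcomp Require Import measurable_realfun.
Import Order.TTheory GRing.Theory Num.Theory.
Import numFieldNormedType.Exports.
Import HBNNSimple.
Local Open Scope classical_set_scope.
Local Open Scope ring_scope.

(** * Real quadratic forms *)

(** Integer vectors serve twice. A finite set of them replaces an epsilon-net of the sphere:
    rounding is explicit, and counting needs a product of geometric series instead of volumes. All
    of them together form a countable family of tests, which makes the event about the singular
    values measurable although [singular_values] is a choice. The four squares coming from one row
    are dependent, so independence is used across rows only; within a row an arithmetic-geometric
    mean inequality replaces it, at the price of a factor 4 in the exponential parameter. Since E
    <A_i, x>^2 is exactly 1, the linear term of the exponent cancels after centring, and the
    remaining quadratic term leads to K^4 in the failure probability. *)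

Definition qform {R : pzRingType} {m : nat} (S : 'M[R]_m) (x : 'cV[R]_m) : R :=
  dotv x (S *m x).

Lemma dotvE {R : pzRingType} {m : nat} (x y : 'cV[R]_m) :
  dotv x y = \sum_i x i ord0 * y i ord0.
Proof. by rewrite /dotv mxE; apply: eq_bigr => i _; rewrite mxE. Qed.

Lemma dotvC {R : comPzRingType} {m : nat} (x y : 'cV[R]_m) :
  dotv x y = dotv y x.
Proof. by rewrite !dotvE; apply: eq_bigr => i _; rewrite mulrC. Qed.

Lemma dotvDl {R : pzRingType} {m : nat} (x y z : 'cV[R]_m) :
  dotv (x + y) z = dotv x z + dotv y z.
Proof. by rewrite /dotv linearD mulmxDl mxE. Qed.

Lemma dotvDr {R : pzRingType} {m : nat} (x y z : 'cV[R]_m) :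
  dotv z (x + y) = dotv z x + dotv z y.
Proof. by rewrite /dotv mulmxDr mxE. Qed.

Lemma dotvZl {R : comPzRingType} {m : nat} a (x y : 'cV[R]_m) :
  dotv (a *: x) y = a * dotv x y.
Proof. by rewrite /dotv linearZ -scalemxAl mxE. Qed.

Lemma dotvZr {R : comPzRingType} {m : nat} a (x y : 'cV[R]_m) :
  dotv x (a *: y) = a * dotv x y.
Proof. by rewrite /dotv -scalemxAr mxE. Qed.

Lemma dotv_ge0 {R : realDomainType} {m : nat} (x : 'cV[R]_m) : 0 <= dotv x x.
Proof. by rewrite dotvE sumr_ge0// => i _; rewrite -expr2 sqr_ge0. Qed.

Lemma dotv_eq0 {R : realDomainType} {m : nat} (x : 'cV[R]_m) :
  (dotv x x == 0) = (x == 0).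
Proof.
apply/idP/eqP => [|->]; last by rewrite dotvE big1// => i _; rewrite mxE mul0r.
rewrite dotvE psumr_eq0 => [/allP h|i _]; last by rewrite -expr2 sqr_ge0.
apply/colP => i; rewrite mxE; apply/eqP.
by have := h i (mem_index_enum i); rewrite mulf_eq0 orbb.
Qed.

Lemma qformZ {R : comPzRingType} {m : nat} (S : 'M[R]_m) a x :
  qform S (a *: x) = a ^+ 2 * qform S x.
Proof. by rewrite /qform -scalemxAr dotvZl dotvZr mulrA expr2. Qed.

Lemma qform_sym {R : comPzRingType} {m : nat} (S : 'M[R]_m) x y :
  S^T = S -> dotv x (S *m y) = dotv y (S *m x).
Proof.
by move=> sS; rewrite dotvC /dotv trmx_mul sS mulmxA.
Qed.

Lemma qformD {R : comPzRingType} {m : nat} (S : 'M[R]_m) x y : S^T = S ->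
  qform S (x + y) = qform S x + 2 * dotv x (S *m y) + qform S y.
Proof.
move=> sS; rewrite /qform mulmxDr !dotvDl !dotvDr (qform_sym S y x sS).
by ring.
Qed.

(* Polarization: the cross term is read off the values of S at h x +- y. *)
Lemma qform_near {R : realFieldType} {m : nat} (S : 'M[R]_m) (s h : R) x y :
  S^T = S -> 0 < h -> (forall z, `|qform S z| <= s * dotv z z) ->
  `|qform S (x + y) - qform S x - qform S y| <=
    s * (h * dotv x x + h^-1 * dotv y y).
Proof.
move=> sS h0 Ss; rewrite qformD//.
set B := dotv x (S *m y).
have -> : qform S x + 2 * B + qform S y - qform S x - qform S y = 2 * B by ring.
have hB : 4 * h * B = qform S (h *: x + y) - qform S (h *: x - y).
  rewrite !qformD// -(scaleN1r y) -scalemxAr !dotvZl dotvZr -/B (qformZ S (-1)).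
  ring.
have e1 := Ss (h *: x + y); have e2 := Ss (h *: x - y).
have hh : dotv (h *: x + y) (h *: x + y) + dotv (h *: x - y) (h *: x - y) =
    2 * h * (h * dotv x x + h^-1 * dotv y y).
  rewrite -(scaleN1r y) !dotvDl !dotvDr !dotvZl !dotvZr.
  by field; rewrite gt_eqF.
have : `|4 * h * B| <= s * (2 * h * (h * dotv x x + h^-1 * dotv y y)).
  by rewrite hB -hh mulrDr (le_trans (ler_normB _ _))// lerD.
have -> : 4 * h * B = (2 * h) * (2 * B) by ring.
rewrite normrM gtr0_norm; last by rewrite mulr_gt0.
by rewrite mulrCA ler_pM2l// mulr_gt0.
Qed.

(** Each [|x_i| |x_j|] is at most [dotv x x]. The constant is crude; only its existence matters, for
    the rounding errors and for the infimum in [qform_net]. *)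
Lemma qform_bounded {R : realFieldType} {m : nat} (S : 'M[R]_m) :
  exists2 s : R, 0 <= s & forall x, `|qform S x| <= s * dotv x x.
Proof.
exists (\sum_i \sum_j `|S i j|) => [|x].
  by rewrite !sumr_ge0// => i _; rewrite sumr_ge0.
rewrite /qform [in leLHS]dotvE (le_trans (ler_norm_sum _ _ _))// mulr_suml.
apply: ler_sum => i _; rewrite mxE mulr_sumr mulr_suml.
rewrite (le_trans (ler_norm_sum _ _ _))//; apply: ler_sum => j _.
rewrite !normrM mulrCA ler_wpM2l//.
have sq k : `|x k ord0| ^+ 2 <= dotv x x.
  rewrite real_normK ?num_real// dotvE (bigD1 k)//= -expr2 lerDl.
  by rewrite sumr_ge0// => l _; rewrite -expr2 sqr_ge0.
have := sqr_ge0 (`|x i ord0| - `|x j ord0|); have := sq i; have := sq j.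
by nra.
Qed.

(** * Rounding to integer vectors *)

Lemma floor_vector {R : realType} {m : nat} (w : 'cV[R]_m) :
  let z := map_mx Num.floor w in
  dotv (w - map_mx intr z) (w - map_mx intr z) <= m%:R /\
  (\sum_i `|z i ord0|%N)%:R <= \sum_i (`|w i ord0| + 1).
Proof.
split.
  rewrite dotvE (@le_trans _ _ (\sum_(i < m) 1))//; last first.
    by rewrite sumr_const card_ord.
  apply: ler_sum => i _; rewrite !mxE.
  have /andP[h1 h2] := floor_itv (w i ord0).
  rewrite intrD in h2; nra.
rewrite natr_sum; apply: ler_sum => i _; rewrite mxE natr_absz.
have /andP[h1 h2] := floor_itv (w i ord0); rewrite intrD in h2.
rewrite intr_norm; set f := (Num.floor _)%:~R in h1 h2 *.
have -> : f = w i ord0 - (w i ord0 - f) by ring.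
rewrite (le_trans (ler_normB _ _))// lerD2l ger0_norm ?subr_ge0//.
by rewrite lerBlDl ltW.
Qed.

(** A negative value at [x] grows like [k ^+ 2] along [k *: x], while rounding costs an arbitrarily
    small multiple of [k ^+ 2] plus a constant; so for large [k] the rounded vector would have a
    negative value. *)
Lemma qform_int_ge0 {R : realType} {m : nat} (S : 'M[R]_m) : S^T = S ->
  (forall z : 'cV[int]_m, 0 <= qform S (map_mx intr z)) ->
  forall x, 0 <= qform S x.
Proof.
move=> sS Sz x; rewrite leNgt; apply/negP => Sx.
have [s s0 Ss] := qform_bounded S.
pose d := - qform S x.
have d0 : 0 < d by rewrite oppr_gt0.
have X0 := dotv_ge0 x.
(* With this weight the part of the rounding error that grows with [k] consumes at most half of
   [k ^+ 2 * d]; the [+ 1] keeps the denominator positive. *)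
pose h := d / (2 * (s * dotv x x + 1)).
have den0 : 0 < 2 * (s * dotv x x + 1) by have := mulr_ge0 s0 X0; lra.
have h0 : 0 < h by rewrite divr_gt0.
have hd : s * h * dotv x x <= d / 2.
  have -> : d / 2 = h * (s * dotv x x + 1).
    by rewrite /h; field; rewrite gt_eqF//; have := mulr_ge0 s0 X0; lra.
  by have := mulr_ge0 s0 X0; nra.
pose D := s * m%:R + s * (h^-1 * m%:R).
have D0 : 0 <= D.
  by rewrite addr_ge0// !mulr_ge0// ?ler0n// invr_ge0 ltW.
(* Chosen so that [k * d = d + 2 * D]; as [1 <= k], half of [k ^+ 2 * d] then exceeds the remaining
   error [D]. *)
pose k : R := 1 + 2 * D / d.
have k1 : 1 <= k by rewrite lerDl !mulr_ge0// invr_ge0 ltW.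
have kD : k * d = d + 2 * D by rewrite /k; field; rewrite gt_eqF.
pose z := map_mx Num.floor (k *: x).
have [fm _] := floor_vector (k *: x); rewrite -/z in fm.
set f := k *: x - map_mx intr z in fm.
have ez : k *: x + (- f) = map_mx intr z by rewrite /f opprB addrC subrK.
have Nf : dotv (- f) (- f) = dotv f f.
  by rewrite -(scaleN1r f) dotvZl dotvZr; ring.
have := qform_near S s h (k *: x) (- f) sS h0 Ss.
rewrite ez qformZ dotvZl dotvZr Nf => near1.
have := Ss (- f); rewrite Nf => near2.
have z0 := Sz z.
have hm : s * (h^-1 * dotv f f) <= s * (h^-1 * m%:R).
  by rewrite !ler_wpM2l// invr_ge0 ltW.
have fm' : s * dotv f f <= s * m%:R by rewrite ler_wpM2l.
have a1 := ler_norm (qform S (map_mx intr z) - k ^+ 2 * qform S x - qform S (- f)).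
have a2 := ler_norm (qform S (- f)).
have : k ^+ 2 * d <= s * (h * (k * (k * dotv x x))) + D.
  by rewrite /D /d; lra.
have -> : s * (h * (k * (k * dotv x x))) = k ^+ 2 * (s * h * dotv x x) by ring.
have k2 : k ^+ 2 * (s * h * dotv x x) <= k ^+ 2 * (d / 2).
  by rewrite ler_wpM2l// sqr_ge0.
have : D < k ^+ 2 * d / 2.
  have -> : k ^+ 2 * d / 2 = k * (k * d) / 2 by ring.
  by rewrite kD; have := ler_wpM2r (addr_ge0 (ltW d0) (addr_ge0 D0 D0)) k1; lra.
lra.
Qed.

(** Rounding a vector [w] of length [4 sqrt m] moves it by at most [|w| / 4]. Hence the rounded [z]
    has [|z|^2 <= (5/4)^2 |w|^2], the source of 25/16, and the rounding errors amount to at most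
    [2 (1/4) + (1/4)^2 = 9/16] of [s |w|^2]. *)
Lemma qform_net_step {R : realType} {m : nat} (S : 'M[R]_m) (e s : R) :
  S^T = S -> 0 <= e -> 0 <= s ->
  (forall x, `|qform S x| <= s * dotv x x) ->
  (forall z : 'cV[int]_m, (\sum_i `|z i ord0| <= 5 * m)%N ->
     `|qform S (map_mx intr z)| <= e * dotv (map_mx intr z) (map_mx intr z)) ->
  forall x, `|qform S x| <= (25 / 16 * e + 9 / 16 * s) * dotv x x.
Proof.
move=> sS e0 s0 Ss Sz x.
have [->|x0] := eqVneq x 0.
  by apply: le_trans (Ss 0) _; rewrite dotvE big1 ?mulr0// => i _; rewrite mxE mul0r.
have X0 : 0 < dotv x x by rewrite lt_neqAle eq_sym dotv_eq0 x0 dotv_ge0.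
have m0 : (0 < m)%N.
  by case: m S sS Ss Sz x x0 {X0} => // S _ _ _ x /eqP[]; apply/colP => -[].
have m0R : 0 < m%:R :> R by rewrite ltr0n.
pose a := Num.sqrt (16 * m%:R / dotv x x).
have a0 : 0 < a by rewrite sqrtr_gt0 divr_gt0// mulr_gt0.
have a2 : a ^+ 2 = 16 * m%:R / dotv x x.
  by rewrite sqr_sqrtr// divr_ge0// ?ltW// mulr_gt0.
pose w := a *: x.
have wm : dotv w w = 16 * m%:R.
  by rewrite dotvZl dotvZr mulrA -expr2 a2 divfK// gt_eqF.
suff H : `|qform S w| <= (25 / 16 * e + 9 / 16 * s) * dotv w w.
  move: H; rewrite qformZ dotvZl dotvZr normrM ger0_norm ?sqr_ge0//.
  have -> : (25 / 16 * e + 9 / 16 * s) * (a * (a * dotv x x)) =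
    a ^+ 2 * ((25 / 16 * e + 9 / 16 * s) * dotv x x) by ring.
  by rewrite ler_pM2l// exprn_gt0.
pose z := map_mx Num.floor w.
have [fm zw] := floor_vector w; rewrite -/z in fm zw.
have z5 : (\sum_i `|z i ord0| <= 5 * m)%N.
  rewrite -(ler_nat R) (le_trans zw)//.
  (* By [(|w_i| - 4)^2 >= 0] each [|w_i| + 1] is at most [w_i^2 / 8 + 3]; these add up to
     [2 m + 3 m], the radius of the net. *)
  apply: (@le_trans _ _ (\sum_(i < m) ((w i ord0 * w i ord0) / 8 + 3))).
    apply: ler_sum => i _; have := sqr_ge0 (`|w i ord0| - 4).
    have -> : w i ord0 * w i ord0 = `|w i ord0| ^+ 2.
      by rewrite real_normK ?num_real// expr2.
    by nra.
  rewrite big_split/= -mulr_suml -dotvE wm sumr_const card_ord natrM -mulr_natr.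
  by lra.
have := Sz z z5; set f := w - map_mx intr z in fm.
have ez : w + (- f) = map_mx intr z by rewrite /f opprB addrC subrK.
have Nf : dotv (- f) (- f) = dotv f f.
  by rewrite -(scaleN1r f) dotvZl dotvZr; ring.
have h0 : 0 < 4^-1 :> R by rewrite invr_gt0.
have := qform_near S s 4^-1 w (- f) sS h0 Ss.
rewrite ez Nf invrK wm => near1.
have := Ss (- f); rewrite Nf => near2 near3.
(* The same polarization for the identity form bounds [|z|^2] by [16 m + m + 8 m = 25 m]. *)
have id_bounded (u : 'cV[R]_m) : `|qform 1%:M u| <= 1 * dotv u u.
  by rewrite /qform mul1mx mul1r ger0_norm ?dotv_ge0.
have := qform_near 1%:M 1 4^-1 w (- f) (trmx1 _ _) h0 id_bounded.
rewrite ez /qform !mul1mx Nf invrK wm -!/(qform S _) => near4.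
have zz : dotv (map_mx intr z) (map_mx intr z) <= 25 * m%:R :> R.
  by have := le_trans (ler_norm _) near4; lra.
have ee := ler_wpM2l e0 zz; have ss := ler_wpM2l s0 fm.
have t3 := ler_normD (qform S w - qform S (map_mx intr z) + qform S (- f))
  (qform S (map_mx intr z) - qform S (- f)).
have t2 := ler_normB (qform S (map_mx intr z)) (qform S (- f)).
have -> : qform S w = (qform S w - qform S (map_mx intr z) + qform S (- f)) +
  (qform S (map_mx intr z) - qform S (- f)) by ring.
have e1 : `|qform S w - qform S (map_mx intr z) + qform S (- f)| =
   `|qform S (map_mx intr z) - qform S w - qform S (- f)|.
  by rewrite -normrN; congr `|_|; ring.
rewrite e1 in t3; apply: le_trans t3 _.
by lra.
Qed.

(** The infimum [i] of the admissible constants is itself admissible, so one net step yields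
    [i <= 25/16 e + 9/16 i], that is [i <= 25/7 e]. *)
Lemma qform_net {R : realType} {m : nat} (S : 'M[R]_m) (e : R) :
  S^T = S -> 0 <= e ->
  (forall z : 'cV[int]_m, (\sum_i `|z i ord0| <= 5 * m)%N ->
     `|qform S (map_mx intr z)| <= e * dotv (map_mx intr z) (map_mx intr z)) ->
  forall x, `|qform S x| <= 4 * e * dotv x x.
Proof.
move=> sS e0 Sz.
pose P := [set s : R | 0 <= s /\ forall x, `|qform S x| <= s * dotv x x].
have P0 : P !=set0 by have [s s0 Ss] := qform_bounded S; exists s.
have lP : has_lbound P by exists 0 => s [].
have i0 : 0 <= inf P by apply: lb_le_inf => // s [].
have iP x : `|qform S x| <= inf P * dotv x x.
  have [X0|X0] := ltP 0 (dotv x x).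
    rewrite -ler_pdivrMr//; apply: lb_le_inf => // s [_ /(_ x)].
    by rewrite ler_pdivrMr.
  have [s [_ /(_ x)]] := P0.
  by have /eqP -> : dotv x x == 0; rewrite ?mulr0// eq_le X0 dotv_ge0.
have : inf P <= 25 / 16 * e + 9 / 16 * inf P.
  apply: ge_inf => //; split; first by lra.
  exact: qform_net_step.
move=> h x; apply: le_trans (iP x) _; apply: ler_wpM2r; first exact: dotv_ge0.
lra.
Qed.

(** * Counting small integer vectors *)

Lemma sum_geometric_le2 {R : realFieldType} (x : R) (n : nat) :
  0 <= x <= 2^-1 -> \sum_(k < n) x ^+ k <= 2.
Proof.
move=> /andP[x0 x2]; elim: n => [|n IH]; first by rewrite big_ord0.
rewrite big_ord_recl expr0; under eq_bigr do rewrite exprS.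
rewrite -mulr_sumr; have : 0 <= \sum_(k < n) x ^+ k.
  by rewrite sumr_ge0// => k _; rewrite exprn_ge0.
by nra.
Qed.

(* The weight [2 ^ (5 m - |z|_1)] is at least 1 on the vectors to be counted,
   and its sum over all integer vectors factors over the coordinates. *)
Lemma small_int_vectors (m : nat) :
  exists F : seq 'cV[int]_m, (size F <= 2 ^ (7 * m))%N /\
    forall z : 'cV[int]_m, (\sum_i `|z i ord0| <= 5 * m)%N -> z \in F.
Proof.
(* Absolute value and sign of a coordinate; the two codes of 0 do no harm in an upper bound. *)
pose J : finType := ('I_(5 * m).+1 * bool)%type.
pose P := [pred f : {ffun 'I_m -> J} | (\sum_i (f i).1 <= 5 * m)%N].
pose v (f : {ffun 'I_m -> J}) : 'cV[int]_m :=
  \col_i (if (f i).2 then - (f i).1%:Z else (f i).1%:Z).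
exists [seq v f | f in P]; split; last first.
  move=> z z5; apply/mapP.
  have zi i : (`|z i ord0| < (5 * m).+1)%N.
    by rewrite ltnS (leq_trans _ z5)// (bigD1 i)//= leq_addr.
  exists [ffun i => (Ordinal (zi i), z i ord0 < 0)].
    by rewrite mem_enum inE; under eq_bigr do rewrite ffunE.
  apply/colP => i; rewrite mxE ffunE/= abszE.
  case: ltrP => h; first by rewrite ltr0_norm// opprK.
  by rewrite ger0_norm.
rewrite size_map -cardE -(ler_nat rat).
have -> : #|P|%:R = \sum_(f in P) (1 : rat).
  by rewrite sumr_const.
apply: (@le_trans _ _ (\sum_(f : {ffun (ordinal m) -> J})
    \prod_i (2 ^+ 5 * 2^-1 ^+ (f i).1 : rat))).
  rewrite [leRHS](bigID P)/= -[leLHS]addr0 lerD//; last first.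
    by rewrite sumr_ge0// => f _; rewrite prodr_ge0// => i _; rewrite mulr_ge0.
  apply: ler_sum => f /= fP; rewrite big_split/= prodr_const card_ord -exprM.
  rewrite prodrXr exprVn ler_pdivlMr ?exprn_gt0// mul1r.
  by rewrite ler_eXn2l.
rewrite -(bigA_distr_bigA (fun _ (j : J) => 2 ^+ 5 * 2^-1 ^+ j.1)).
rewrite prodr_const card_ord natrX exprM; apply: lerXn2r.
- by rewrite nnegrE sumr_ge0// => j _; rewrite mulr_ge0.
- by rewrite nnegrE.
rewrite -mulr_sumr -(pair_bigA _ (fun (k : 'I_(5 * m).+1) (b : bool) => (2^-1) ^+ k))/=.
under eq_bigr do rewrite sumr_const card_bool.
rewrite sumrMnl; have := sum_geometric_le2 (2^-1 : rat) (5 * m).+1 isT.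
set x := \sum_(_ < _) _ => x2; rewrite -(mulr_natl x).
(* Per coordinate: [2 ^+ 5] from the weight, 2 for the sign, 2 for the geometric series. *)
have -> : 2 ^+ 7 = 2 ^+ 5 * (2 * 2) :> rat by rewrite -!expr2 -exprD.
by rewrite ler_wpM2l// ler_wpM2l.
Qed.

(** * Maximum of a quadratic form on the unit sphere *)

Lemma continuous_sum {R : realType} {T : topologicalType} {I : Type}
    (r : seq I) (P : pred I) (F : I -> T -> R) :
  (forall i, continuous (F i)) -> continuous (fun x => \sum_(i <- r | P i) F i x).
Proof.
move=> cF; elim: r => [|i r IH].
  rewrite (_ : (fun x => _) = cst 0); first by move=> x; exact: cvg_cst.
  by apply/funext => x; rewrite big_nil.
pose G x := \sum_(j <- r | P j) F j x.
have [Pi|Pi] := boolP (P i).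
  rewrite (_ : (fun x => _) = F i \+ G); first by move=> x; apply: cvgD; [exact: cF|exact: IH].
  by apply/funext => x; rewrite big_cons Pi.
rewrite (_ : (fun x => _) = G)//.
by apply/funext => x; rewrite big_cons (negPf Pi).
Qed.

Lemma qform_max {R : realType} {m : nat} (S : 'M[R]_m) : (0 < m)%N ->
  exists v, dotv v v = 1 /\ forall x, qform S x <= qform S v * dotv x x.
Proof.
move=> m0.
pose f (x : 'rV[R]_m) : R := \sum_i \sum_j x ord0 i * S i j * x ord0 j.
pose g (x : 'rV[R]_m) : R := \sum_i x ord0 i * x ord0 i.
have fE x : qform S x = f x^T.
  rewrite /qform dotvE /f; apply: eq_bigr => i _.
  by rewrite !mxE mulr_sumr; apply: eq_bigr => j _; rewrite !mxE mulrA.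
have gE x : dotv x x = g x^T.
  by rewrite dotvE; apply: eq_bigr => i _; rewrite !mxE.
have cM (u w : 'rV[R]_m -> R) : continuous u -> continuous w ->
    continuous (fun x => u x * w x).
  by move=> cu cw x; apply: (@continuousM R _ u w); [exact: cu|exact: cw].
have cX i : continuous (fun x : 'rV[R]_m => x ord0 i).
  exact: coord_continuous.
have cf : continuous f.
  apply: continuous_sum => i; apply: continuous_sum => j.
  apply: (cM (fun x => x ord0 i * S i j) (fun x => x ord0 j)); last exact: cX.
  by apply: (cM (fun x => x ord0 i) (fun=> S i j)); [exact: cX|exact: cst_continuous].
have cg : continuous g.
  by apply: continuous_sum => i; exact: cM (cX i) (cX i).
pose A := [set x : 'rV[R]_m | g x = 1].
have cA : compact A.
  apply: bounded_closed_compact.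
    exists 1; split; first exact: num_real.
    move=> M M1 x Ax /=.
    have [y|/mx_norm_neq0[[i j] xmE]] := eqVneq (mx_norm x) 0.
      by rewrite -[leLHS]/(mx_norm x) y; lra.
    rewrite -[leLHS]/(mx_norm x) xmE (ord1 i)/= => {i xmE}.
    have : `|x ord0 j| ^+ 2 <= 1.
      rewrite real_normK ?num_real// -Ax /g (bigD1 j)//= -expr2 lerDl.
      by rewrite sumr_ge0// => k _; rewrite -expr2 sqr_ge0.
    by rewrite expr_le1// => /le_trans; apply; exact: ltW.
  have -> : A = g @^-1` [set 1] by [].
  by apply: (preimage_closed _ (@closed_eq _ _)) => x _; exact: cg.
have A0 : A !=set0.
  exists (delta_mx ord0 (Ordinal m0)).
  rewrite /A/= /g (bigD1 (Ordinal m0))//= big1 => [|i /negPf i0].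
    by rewrite mxE !eqxx mulr1 addr0.
  by rewrite mxE i0 andbF mulr0.
have [v vA vmax] := @compact_EVT_max _ _ f A A0 cA (continuous_subspaceT cf).
rewrite inE /A/= in vA.
exists v^T; rewrite gE fE trmxK; split => // x.
have [->|x0] := eqVneq x 0.
  have [s _ /(_ 0)] := qform_bounded S.
  have -> : dotv (0 : 'cV[R]_m) 0 = 0 by apply/eqP; rewrite dotv_eq0.
  by rewrite !mulr0 => /(le_trans (ler_norm _)).
have X0 : 0 < dotv x x by rewrite lt_neqAle eq_sym dotv_eq0 x0 dotv_ge0.
pose a := (Num.sqrt (dotv x x))^-1.
have a2 : a ^+ 2 * dotv x x = 1.
  by rewrite exprVn sqr_sqrtr ?ltW// mulVf// gt_eqF.
have /vmax : (a *: x)^T \in A.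
  by rewrite inE /A/= -gE dotvZl dotvZr mulrA -expr2 a2.
rewrite -fE qformZ => h.
rewrite -(ler_pM2l (exprn_gt0 2 _ : 0 < a ^+ 2)) ?invr_gt0 ?sqrtr_gt0//.
by rewrite mulrCA a2 mulr1.
Qed.

(** * Quaternion matrices *)

Lemma qconjD {R : comNzRingType} : {morph @qconj R : a b / a + b}.
Proof. by case=> [aw ax ay az] [bw bx b_ bz]; congr Quat => /=; ring. Qed.

Lemma qconj0 {R : comNzRingType} : qconj (0 : quat R) = 0.
Proof. by congr Quat; rewrite /= oppr0. Qed.

Lemma qconj1 {R : comNzRingType} : qconj (1 : quat R) = 1.
Proof. by congr Quat; rewrite /= oppr0. Qed.

Lemma qconjK {R : comNzRingType} : involutive (@qconj R).
Proof. by case=> *; congr Quat; rewrite /= opprK. Qed.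

Lemma qconjM {R : comNzRingType} (a b : quat R) :
  qconj (a * b) = qconj b * qconj a.
Proof. by congr Quat => /=; ring. Qed.

Lemma qconj_sum {R : comNzRingType} {I : Type} r (P : pred I) (F : I -> quat R) :
  qconj (\sum_(i <- r | P i) F i) = \sum_(i <- r | P i) qconj (F i).
Proof. by rewrite (big_morph _ qconjD qconj0). Qed.

Lemma qwD {R : comNzRingType} : {morph @qw R : a b / a + b}.
Proof. by []. Qed.

Lemma qw_sum {R : comNzRingType} {I : Type} r (P : pred I) (F : I -> quat R) :
  qw (\sum_(i <- r | P i) F i) = \sum_(i <- r | P i) qw (F i).
Proof. by rewrite (big_morph _ qwD (erefl : qw 0 = 0)). Qed.

Lemma qrealD {R : comNzRingType} : {morph @qreal R : a b / a + b}.
Proof. by move=> a b; congr Quat; rewrite /= addr0. Qed.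

Lemma qrealM {R : comNzRingType} : {morph @qreal R : a b / a * b}.
Proof. by move=> a b; congr Quat => /=; ring. Qed.

Lemma qreal_sum {R : comNzRingType} {I : Type} r (P : pred I) (F : I -> R) :
  qreal (\sum_(i <- r | P i) F i) = \sum_(i <- r | P i) qreal (F i).
Proof. by rewrite (big_morph _ qrealD (erefl : qreal 0 = 0)). Qed.

Lemma qrealC {R : comNzRingType} (c : R) (a : quat R) :
  qreal c * a = a * qreal c.
Proof. by case: a => *; congr Quat => /=; ring. Qed.

Lemma qconj_real {R : comNzRingType} (c : R) : qconj (qreal c) = qreal c.
Proof. by congr Quat; rewrite /= oppr0. Qed.

Definition qnorm2 {R : comNzRingType} (a : quat R) : R :=
  qw a ^+ 2 + qx a ^+ 2 + qy a ^+ 2 + qz a ^+ 2.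

Lemma qmul_conj {R : comNzRingType} (a : quat R) :
  qconj a * a = qreal (qnorm2 a).
Proof. by rewrite /qnorm2; congr Quat => /=; ring. Qed.

(** Euler's four-square identity. *)
Lemma qnorm2M {R : comNzRingType} (a b : quat R) :
  qnorm2 (a * b) = qnorm2 a * qnorm2 b.
Proof. by rewrite /qnorm2 /=; ring. Qed.

Lemma qnorm2_ge0 {R : realDomainType} (a : quat R) : 0 <= qnorm2 a.
Proof. by rewrite !addr_ge0 ?sqr_ge0. Qed.

Lemma qnorm2_real {R : comNzRingType} (c : R) : qnorm2 (qreal c) = c ^+ 2.
Proof. by rewrite /qnorm2 /=; ring. Qed.

Lemma qnorm2_conj {R : comNzRingType} (a : quat R) : qnorm2 (qconj a) = qnorm2 a.
Proof. by rewrite /qnorm2 /=; ring. Qed.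

Lemma qnorm20 {R : comNzRingType} : qnorm2 (0 : quat R) = 0.
Proof. by rewrite /qnorm2 /=; ring. Qed.

Lemma qnorm2_eq0 {R : realDomainType} (a : quat R) : qnorm2 a = 0 -> a = 0.
Proof.
case: a => w x y z; rewrite /qnorm2 /= => h.
have [h1 h2 h3 h4] := And4 (sqr_ge0 w) (sqr_ge0 x) (sqr_ge0 y) (sqr_ge0 z).
by congr Quat; apply/eqP; rewrite -sqrf_eq0; apply/eqP; lra.
Qed.

Lemma qadjointM {R : comNzRingType} {m n p} (A : 'M[quat R]_(m, n)) (B : 'M[quat R]_(n, p)) :
  qadjoint (A *m B) = qadjoint B *m qadjoint A.
Proof.
apply/matrixP => i j; rewrite !mxE qconj_sum; apply: eq_bigr => k _.
by rewrite !mxE qconjM.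
Qed.

Lemma qadjointD {R : comNzRingType} {m n} (A B : 'M[quat R]_(m, n)) :
  qadjoint (A + B) = qadjoint A + qadjoint B.
Proof. by apply/matrixP => i j; rewrite !mxE qconjD. Qed.

Lemma qadjointN {R : comNzRingType} {m n} (A : 'M[quat R]_(m, n)) : qadjoint (- A) = - qadjoint A.
Proof. by apply/matrixP => i j; rewrite !mxE; congr Quat. Qed.

Lemma qadjointZ {R : comNzRingType} {m n} (c : R) (A : 'M[quat R]_(m, n)) :
  qadjoint (qreal c *: A) = qreal c *: qadjoint A.
Proof. by apply/matrixP => i j; rewrite !mxE qconjM qconj_real qrealC. Qed.

Lemma qadjointK {R : comNzRingType} {m n} (A : 'M[quat R]_(m, n)) : qadjoint (qadjoint A) = A.
Proof. by apply/matrixP => i j; rewrite !mxE qconjK. Qed.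

Lemma qadjoint_scalar {R : comNzRingType} {n} (a : quat R) :
  qadjoint (a%:M : 'M[quat R]_n) = (qconj a)%:M.
Proof.
apply/matrixP => i j; rewrite !mxE eq_sym; case: eqP => _; rewrite ?mulr0n ?mulr1n//.
exact: qconj0.
Qed.

Lemma qadjoint0 {R : comNzRingType} {m n} : qadjoint (0 : 'M[quat R]_(m, n)) = 0.
Proof. by apply/matrixP => i j; rewrite !mxE qconj0. Qed.

Lemma qadjoint_block {R : comNzRingType} {m1 m2 n1 n2} (A : 'M[quat R]_(m1, n1)) B C
    (D : 'M[quat R]_(m2, n2)) :
  qadjoint (block_mx A B C D) =
  block_mx (qadjoint A) (qadjoint C) (qadjoint B) (qadjoint D).
Proof. by rewrite /qadjoint map_block_mx tr_block_mx. Qed.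

Lemma qunitaryM {R : comNzRingType} {n} (U V : 'M[quat R]_n) :
  qunitary U -> qunitary V -> qunitary (U *m V).
Proof.
move=> [u1 u2] [v1 v2]; split; rewrite qadjointM.
  by rewrite -mulmxA (mulmxA _ U) u1 mul1mx.
by rewrite -mulmxA (mulmxA V) v2 mul1mx.
Qed.

Lemma qunitary1 {R : comNzRingType} {n} : qunitary (1%:M : 'M[quat R]_n).
Proof. by split; rewrite qadjoint_scalar qconj1 mulmx1. Qed.

Lemma qunitary_adjoint {R : comNzRingType} {n} (U : 'M[quat R]_n) :
  qunitary U -> qunitary (qadjoint U).
Proof. by move=> [u1 u2]; split; rewrite qadjointK. Qed.

Lemma qunitary_block {R : comNzRingType} {n} (U : 'M[quat R]_n) : qunitary U ->
  qunitary (block_mx (1%:M : 'M[quat R]_1) 0 0 U).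
Proof.
move=> [u1 u2]; split; rewrite qadjoint_block !qadjoint0 qadjoint_scalar qconj1.
  by rewrite mulmx_block !(mulmx0, mul0mx, mulmx1, addr0, add0r) u1 scalar_mx_block.
by rewrite mulmx_block !(mulmx0, mul0mx, mulmx1, addr0, add0r) u2 scalar_mx_block.
Qed.

(** Scalars act on the left and entries do not commute; a real scalar passes through [A] because it
    is central. *)
Lemma mulmx_qrealZ {R : comNzRingType} {m n p} (c : R) (A : 'M[quat R]_(m, n))
    (B : 'M[quat R]_(n, p)) :
  A *m (qreal c *: B) = qreal c *: (A *m B).
Proof.
apply/matrixP => i j; rewrite !mxE mulr_sumr; apply: eq_bigr => k _.
by rewrite !mxE mulrA -qrealC mulrA.
Qed.

Definition cnorm2 {R : comNzRingType} {n} (x : 'cV[quat R]_n) : R := \sum_i qnorm2 (x i ord0).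

Lemma qadjoint_cnorm2 {R : comNzRingType} {n} (x : 'cV[quat R]_n) :
  qadjoint x *m x = (qreal (cnorm2 x))%:M.
Proof.
apply/matrixP => i j; rewrite !ord1 !mxE mulr1n /cnorm2 qreal_sum.
by apply: eq_bigr => k _; rewrite !mxE qmul_conj.
Qed.

Lemma cnorm2_qadjoint {R : comNzRingType} {n} (x : 'cV[quat R]_n) :
  cnorm2 x = qw ((qadjoint x *m x) ord0 ord0).
Proof. by rewrite qadjoint_cnorm2 mxE. Qed.

Lemma cnorm2_unitary {R : comNzRingType} {n} (U : 'M[quat R]_n) (x : 'cV_n) : qunitary U ->
  cnorm2 (U *m x) = cnorm2 x.
Proof.
move=> [u1 _].
by rewrite !cnorm2_qadjoint qadjointM -mulmxA (mulmxA _ U) u1 mul1mx.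
Qed.

(** With a 1 by 1 scalar matrix, [x *m a%:M] is the right multiple of [x], the one that commutes
    with left multiplication by matrices. *)
Lemma cnorm2Zr {R : comNzRingType} {n} (x : 'cV[quat R]_n) a :
  cnorm2 (x *m a%:M) = cnorm2 x * qnorm2 a.
Proof.
rewrite /cnorm2 mulr_suml; apply: eq_bigr => i _.
by rewrite !mxE big_ord1 mxE mulr1n qnorm2M.
Qed.


Lemma cnorm2_ge0 {R : realDomainType} {n} (x : 'cV[quat R]_n) : 0 <= cnorm2 x.
Proof. by rewrite sumr_ge0// => i _; exact: qnorm2_ge0. Qed.

Lemma cnorm2_eq0 {R : realDomainType} {n} (x : 'cV[quat R]_n) :
  cnorm2 x = 0 -> x = 0.
Proof.
move/eqP; rewrite psumr_eq0 => [/allP h|i _]; last exact: qnorm2_ge0.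
apply/colP => i; rewrite mxE; apply: qnorm2_eq0; apply/eqP.
exact: h i (mem_index_enum i).
Qed.

(* Householder reflection: writing [v 0 0 = - a r] with [qnorm2 a = 1] and
   [r >= 0], the vector [u = v - e_0 a] satisfies [u^* u = 2 (1 + r)] and
   [u^* v = 1 + r], so that the reflection along [u] maps [v] to [e_0 a]. *)
Lemma qunitary_completion {R : rcfType} {n} (v : 'cV[quat R]_n.+1) :
  cnorm2 v = 1 ->
  exists U : 'M[quat R]_n.+1, qunitary U /\ U *m delta_mx ord0 ord0 = v.
Proof.
move=> v1; pose e : 'cV[quat R]_n.+1 := delta_mx ord0 ord0.
have [a [r [r0 a1 av]]] : exists a r, [/\ 0 <= r, qnorm2 a = 1 &
    qconj a * v ord0 ord0 = qreal (- r)].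
  pose q := v ord0 ord0.
  have [q0|q0] := eqVneq (qnorm2 q) 0.
    exists 1, 0; split => //; first by rewrite /qnorm2 /=; ring.
    by rewrite -/q (qnorm2_eq0 _ q0) mulr0 oppr0.
  pose r := Num.sqrt (qnorm2 q).
  have r2 : r ^+ 2 = qnorm2 q by rewrite sqr_sqrtr ?qnorm2_ge0.
  have rn0 : r != 0 by rewrite -sqrf_eq0 r2.
  (* [a = - q / |q|]: this sign makes [r] nonnegative, so that the divisor [1 + r] cannot vanish. *)
  exists (qreal (- r^-1) * q), r; split; first exact: sqrtr_ge0.
    by rewrite qnorm2M qnorm2_real -r2; field.
  rewrite qconjM qconj_real -qrealC -mulrA qmul_conj -qrealM -r2.
  by congr qreal; field.
have ee : qadjoint e *m e = 1%:M.
  rewrite qadjoint_cnorm2 /cnorm2 (bigD1 ord0)//= big1 => [|i /negPf i0].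
    by rewrite mxE !eqxx addr0 /qnorm2 /= expr1n expr0n /= !addr0.
  by rewrite mxE i0 qnorm20.
have ev : qadjoint e *m v = (v ord0 ord0)%:M.
  apply/matrixP => i j; rewrite !ord1 !mxE (bigD1 ord0)//= big1 => [|k /negPf k0].
    by rewrite !mxE !eqxx qconj1 mul1r addr0.
  by rewrite !mxE k0 qconj0 mul0r.
pose am : 'M[quat R]_1 := a%:M.
have aam : qadjoint am *m am = 1%:M.
  by rewrite qadjoint_scalar -scalar_mxM qmul_conj a1.
have avm : qadjoint am *m qadjoint e *m v = (qreal (- r))%:M.
  by rewrite qadjoint_scalar -mulmxA ev -scalar_mxM av.
have vam : qadjoint v *m (e *m am) = (qreal (- r))%:M.
  rewrite -[LHS]qadjointK (qadjointM _ (e *m am)) (qadjointM e) qadjointK avm.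
  by rewrite qadjoint_scalar qconj_real.
have vv : qadjoint v *m v = 1%:M by rewrite qadjoint_cnorm2 v1.
pose u := v - e *m am.
have uv : qadjoint u *m v = (qreal (1 + r))%:M.
  rewrite qadjointD qadjointN qadjointM mulmxDl mulNmx avm vv.
  rewrite -[1%:M]/((qreal 1)%:M) -raddfB; congr (_%:M).
  by congr Quat => /=; ring.
have uu : qadjoint u *m u = (qreal (2 * (1 + r)))%:M.
  have ua : qadjoint u *m (e *m am) = (qreal (- (1 + r)))%:M.
    rewrite qadjointD qadjointN qadjointM mulmxDl vam mulNmx mulmxA.
    rewrite -(mulmxA _ _ e) ee mulmx1 aam.
    rewrite -[1%:M]/((qreal 1)%:M) -!raddfB; congr (_%:M).
    by congr Quat => /=; ring.
  rewrite {2}(_ : u = v - e *m am)// mulmxBr uv ua -raddfB; congr (_%:M).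
  by congr Quat => /=; ring.
have k0 : 1 + r != 0 by rewrite gt_eqF//; lra.
pose c := (1 + r)^-1.
(* The reflection [1 - 2 u u^* / (u^* u)] with [u^* u = 2 (1 + r)]. *)
pose H := 1%:M - qreal c *: (u *m qadjoint u).
have Hs : qadjoint H = H.
  rewrite qadjointD qadjointN qadjointZ qadjointM qadjointK qadjoint_scalar.
  by rewrite qconj1.
have HH : H *m H = 1%:M.
  rewrite /H mulmxBl mul1mx mulmxBr mulmx1 -scalemxAl mulmx_qrealZ.
  rewrite mulmxA -(mulmxA u _ u) uu -[(qreal _)%:M]scalemx1 mulmx_qrealZ mulmx1.
  rewrite -scalemxAl !scalerA opprB -!qrealM.
  have -> : c * (c * (2 * (1 + r))) = c + c by rewrite /c; field.
  by rewrite qrealD scalerDl addrK subrK.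
have Hv : H *m v = e *m am.
  rewrite /H mulmxBl mul1mx -scalemxAl -mulmxA uv -[(qreal _)%:M]scalemx1.
  rewrite mulmx_qrealZ mulmx1 scalerA -qrealM mulVf// scale1r.
  by rewrite /u opprB addrC subrK.
(* [e] has real entries, so scaling it by [a] on the left and on the right agree. *)
have ame : a%:M *m e = e *m am.
  apply/matrixP => i j; rewrite !mxE big_ord1 (bigD1 ord0)//= big1 => [|k /negPf k0'].
    rewrite !mxE !ord1 eqxx mulr1 mulr1n addr0 andbT.
    by case: eqP => _; rewrite ?mul1r ?mul0r ?mulr1n ?mulr0n.
  by rewrite !mxE k0' mulr0.
(* [H] is an involution, so it sends [e *m am] back to [v]. *)
exists (H *m a%:M); split; last by rewrite -mulmxA ame -Hv mulmxA HH mul1mx.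
apply: qunitaryM; first by split; rewrite Hs.
rewrite /qunitary qadjoint_scalar -!scalar_mxM qmul_conj a1.
by rewrite -{1}(qconjK a) qmul_conj qnorm2_conj a1.
Qed.

(** * The Gram form and singular values *)

Lemma dotv_realvec {R : comNzRingType} {n} (u v : 'rV[quat R]_n) :
  dotv (realvec u) (realvec v) =
  \sum_j qw (u ord0 j * qconj (v ord0 j)).
Proof.
rewrite dotvE 3!big_split_ord/= -!big_split/=; apply: eq_bigr => j _.
by rewrite !(col_mxEu, col_mxEd) !mxE /=; ring.
Qed.

(** Conjugating [x] cancels the signs in the real part of a quaternion product; this is why columns
    enter as [realvec (qadjoint x)] throughout. *)
Lemma qw_mul_realvec {R : comNzRingType} {n} (a : 'rV[quat R]_n) (x : 'cV_n) :
  qw ((a *m x) ord0 ord0) = dotv (realvec a) (realvec (qadjoint x)).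
Proof.
rewrite dotv_realvec mxE qw_sum; apply: eq_bigr => j _.
by rewrite !mxE qconjK.
Qed.

Lemma dotv_realvec_adjoint {R : comNzRingType} {n} (x : 'cV[quat R]_n) :
  dotv (realvec (qadjoint x)) (realvec (qadjoint x)) = cnorm2 x.
Proof. by rewrite -qw_mul_realvec cnorm2_qadjoint. Qed.

Lemma realvec_adjoint_surj {R : comNzRingType} {n} (y : 'cV[R]_(n + n + (n + n))) :
  exists x : 'cV[quat R]_n, realvec (qadjoint x) = y.
Proof.
pose v : 'rV[quat R]_n := \row_j Quat (y (lshift _ (lshift _ j)) ord0)
  (y (lshift _ (rshift _ j)) ord0) (y (rshift _ (lshift _ j)) ord0)
  (y (rshift _ (rshift _ j)) ord0).
exists (qadjoint v); rewrite qadjointK -[RHS]vsubmxK -(vsubmxK (usubmx y)).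
rewrite -(vsubmxK (dsubmx y)).
by congr (col_mx (col_mx _ _) (col_mx _ _)); apply/colP => j; rewrite !mxE.
Qed.

Definition qbasis (R : pzRingType) (c : 'I_4) : quat R :=
  nth (Quat 1 0 0 0) [:: Quat 1 0 0 0; Quat 0 1 0 0; Quat 0 0 1 0; Quat 0 0 0 1] c.

Lemma qnorm2_basis {R : comNzRingType} c : qnorm2 (qbasis R c) = 1.
Proof. by case: c => -[|[|[|[|]]]]//= h; rewrite /qnorm2 /qbasis /=; ring. Qed.

(** The real parts of [q], [i q], [j q], [k q] are the four components of [q] up to sign. *)
Lemma qnorm2_coords {R : comNzRingType} (q : quat R) :
  qnorm2 q = \sum_(c < 4) qw (qbasis R c * q) ^+ 2.
Proof. by rewrite /qnorm2 !big_ord_recl big_ord0 /=; ring. Qed.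

Lemma qw_mulC {R : comNzRingType} (a b : quat R) : qw (a * b) = qw (b * a).
Proof. by rewrite /=; ring. Qed.

(* Left multiplication of the row by [q] is transferred to a right
   multiplication of the column, since [qw (q s) = qw (s q)]. *)
Lemma dotv_realvecZ {R : comNzRingType} {n} (q : quat R) (a : 'rV[quat R]_n) x :
  dotv (realvec (q *: a)) (realvec (qadjoint x)) =
  dotv (realvec a) (realvec (qadjoint (x *m q%:M))).
Proof.
rewrite -!qw_mul_realvec -scalemxAl mxE qw_mulC mulmxA.
by rewrite [in RHS]mxE big_ord1 [q%:M _ _]mxE eqxx mulr1n.
Qed.

(** This is [B^T B] where the real 4m by 4n matrix [B] represents [A] up to signs of its rows: the
    multiples of a row [a] by 1, i, j, k recover the four components of [a x]. *)
Definition gram {R : comNzRingType} {m n} (A : 'M[quat R]_(m, n)) :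
    'M[R]_(n + n + (n + n)) :=
  \sum_i \sum_(c < 4) (realvec (qbasis R c *: row i A) *m
                       (realvec (qbasis R c *: row i A))^T).

Lemma gram_sym {R : comNzRingType} {m n} (A : 'M[quat R]_(m, n)) :
  (gram A)^T = gram A.
Proof.
rewrite /gram raddf_sum; apply: eq_bigr => i _.
by rewrite raddf_sum; apply: eq_bigr => c _ /=; rewrite trmx_mul trmxK.
Qed.

Lemma qform_gramE {R : comNzRingType} {m n} (A : 'M[quat R]_(m, n)) y :
  qform (gram A) y =
  \sum_i \sum_(c < 4) dotv (realvec (qbasis R c *: row i A)) y ^+ 2.
Proof.
rewrite /qform /gram mulmx_suml /dotv mulmx_sumr summxE; apply: eq_bigr => i _.
rewrite mulmx_suml mulmx_sumr summxE; apply: eq_bigr => c _.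
set r := realvec _; rewrite -(mulmxA r) (mulmxA y^T) [LHS]mxE big_ord1 expr2; congr (_ * _).
exact: dotvC.
Qed.

Lemma qform_gram {R : comNzRingType} {m n} (A : 'M[quat R]_(m, n)) x :
  qform (gram A) (realvec (qadjoint x)) = cnorm2 (A *m x).
Proof.
rewrite qform_gramE; apply: eq_bigr => i _; rewrite qnorm2_coords.
apply: eq_bigr => c _; rewrite -qw_mul_realvec -scalemxAl mxE.
by rewrite -row_mul mxE.
Qed.

Lemma cnorm2_max {R : realType} {m n} (A : 'M[quat R]_(m, n.+1)) :
  exists v, cnorm2 v = 1 /\
    forall x, cnorm2 (A *m x) <= cnorm2 (A *m v) * cnorm2 x.
Proof.
have [|y [y1 ymax]] := qform_max (gram A); first by rewrite !addnS.
have [v vy] := realvec_adjoint_surj y.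
exists v; split; first by rewrite -dotv_realvec_adjoint vy.
by move=> x; have := ymax (realvec (qadjoint x)); rewrite -vy !qform_gram
  dotv_realvec_adjoint.
Qed.

Definition diag_sv {R : comNzRingType} (m n : nat) (s : seq R) : 'M[quat R]_(m, n) :=
  \matrix_(i < m, j < n) (if i == j :> nat then qreal s`_i else 0).

(** A sum over all pairs [(i, j)] with [i = j] can be collapsed along either index, which passes
    from rows to columns although their ranges differ. *)
Lemma cnorm2_diag {R : comNzRingType} {m n} (s : seq R) (y : 'cV[quat R]_n) :
  cnorm2 (diag_sv m n s *m y) =
  \sum_(j < n | (j < m)%N) s`_j ^+ 2 * qnorm2 (y j ord0).
Proof.
have -> : cnorm2 (diag_sv m n s *m y) = \sum_(i < m) \sum_(j < n)
    (if i == j :> nat then s`_j ^+ 2 * qnorm2 (y j ord0) else 0).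
  apply: eq_bigr => i _; rewrite mxE.
  have [ni|ni] := ltnP i n; last first.
    rewrite !big1 ?qnorm20// => j _; last by rewrite mxE; case: eqP => h;
      [move: ni; rewrite h leqNgt ltn_ord | rewrite mul0r].
    by case: eqP => // h; move: ni; rewrite h leqNgt ltn_ord.
  rewrite (bigD1 (Ordinal ni))//= [RHS](bigD1 (Ordinal ni))//= mxE/= !eqxx.
  rewrite !big1 ?addr0 ?qnorm2M ?qnorm2_real// => j /eqP jn.
    by case: eqP => // h; case: jn; apply: val_inj.
  by rewrite mxE; case: eqP => [h|_]; [case: jn; apply: val_inj|rewrite mul0r].
rewrite exchange_big/= [RHS]big_mkcond/=; apply: eq_bigr => j _.
have [mj|mj] := ltnP j m.
  rewrite (bigD1 (Ordinal mj))//= eqxx big1 ?addr0// => i /eqP im.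
  by case: eqP => // h; case: im; apply: val_inj.
rewrite big1// => i _; case: eqP => // h.
by move: mj; rewrite -h leqNgt ltn_ord.
Qed.

Lemma cnorm2_delta {R : comNzRingType} {n} (j : 'I_n) :
  cnorm2 (delta_mx j ord0 : 'cV[quat R]_n) = 1.
Proof.
rewrite /cnorm2 (bigD1 j)//= big1 => [|i /negPf ij].
  by rewrite mxE !eqxx addr0 (qnorm2_real 1) expr1n.
by rewrite mxE ij qnorm20.
Qed.

(** [U] disappears because its adjoint preserves lengths; only the coordinates given by [V] matter
    for [|A x|]. *)
Lemma cnorm2_singular {R : realType} {m n} (A : 'M[quat R]_(m, n)) s :
  is_singular_values A s ->
  exists V, qunitary V /\ forall y, cnorm2 (A *m (V *m y)) =
    \sum_(j < n | (j < m)%N) s`_j ^+ 2 * qnorm2 (y j ord0).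
Proof.
move=> [_ _ _ [U [V [uU uV eA]]]]; exists V; split => // y.
by rewrite -(cnorm2_unitary _ _ (qunitary_adjoint _ uU)) !mulmxA eA cnorm2_diag.
Qed.

Lemma singular_value_attained {R : realType} {m n} (A : 'M[quat R]_(m, n)) s j :
  is_singular_values A s -> (j < n)%N -> (j < m)%N ->
  exists2 x, cnorm2 x = 1 & cnorm2 (A *m x) = s`_j ^+ 2.
Proof.
move=> /cnorm2_singular[V [uV AV]] jn jm.
exists (V *m delta_mx (Ordinal jn) ord0); first by rewrite cnorm2_unitary// cnorm2_delta.
rewrite AV (bigD1 (Ordinal jn))//= big1 => [|i /andP[_ /negPf ij]].
  by rewrite mxE !eqxx addr0 (qnorm2_real 1) expr1n mulr1.
by rewrite mxE ij qnorm20 mulr0.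
Qed.

Lemma cnorm2_col_mx {R : comNzRingType} {m n} (x : 'cV[quat R]_m) (y : 'cV_n) :
  cnorm2 (col_mx x y) = cnorm2 x + cnorm2 y.
Proof.
rewrite /cnorm2 big_split_ord/=.
by congr (_ + _); apply: eq_bigr => i _; rewrite ?col_mxEu ?col_mxEd.
Qed.

Lemma cnorm20 {R : comNzRingType} {n} : cnorm2 (0 : 'cV[quat R]_n) = 0.
Proof. by rewrite /cnorm2 big1// => i _; rewrite mxE qnorm20. Qed.

(* A maximizer of [|A x|] on the unit sphere gives the first pair of singular
   vectors; by maximality the rest of the first row vanishes. *)
Lemma singular_values_exist {R : realType} {m n} (A : 'M[quat R]_(m, n)) :
  exists s, is_singular_values A s.
Proof.
elim: m n A => [|m IH] [|n] A.
- exists [::]; split => //; exists 1%:M, 1%:M.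
  by split; [exact: qunitary1|exact: qunitary1|apply/matrixP => -[]].
- exists [::]; split => //; exists 1%:M, 1%:M.
  by split; [exact: qunitary1|exact: qunitary1|apply/matrixP => -[]].
- exists [::]; split => //; exists 1%:M, 1%:M.
  by split; [exact: qunitary1|exact: qunitary1|apply/matrixP => ? -[]].
have [v [v1 vmax]] := cnorm2_max A.
pose sg := Num.sqrt (cnorm2 (A *m v)).
have sg2 : sg ^+ 2 = cnorm2 (A *m v) by rewrite sqr_sqrtr ?cnorm2_ge0.
pose e k : 'cV[quat R]_k.+1 := delta_mx ord0 ord0.
have [u u1 Av] : exists2 u, cnorm2 u = 1 & A *m v = qreal sg *: u.
  have [s0|s0] := eqVneq sg 0.
    (* [A v = 0] here, so any unit vector serves as [u]. *)
    exists (e m); first exact: cnorm2_delta.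
    rewrite s0 scale0r; apply: cnorm2_eq0; rewrite -sg2 s0 expr0n//.
  exists (qreal sg^-1 *: (A *m v)); last first.
    by rewrite scalerA -qrealM mulfV// scale1r.
  rewrite -[RHS](mulVf (expf_neq0 2 s0)) {2}sg2 /cnorm2 mulr_sumr.
  by apply: eq_bigr => i _; rewrite mxE qnorm2M qnorm2_real exprVn.
have [U [uU]] := qunitary_completion _ u1; rewrite -/(e m) => Ue.
have [V [uV]] := qunitary_completion _ v1; rewrite -/(e n) => Ve.
have [M MM] : exists M : 'M[quat R]_(1 + m, 1 + n), M = qadjoint U *m A *m V.
  by exists (qadjoint U *m A *m V).
have Me : M *m e n = qreal sg *: e m.
  rewrite MM -(mulmxA _ V (e n)) Ve -mulmxA Av mulmx_qrealZ -Ue mulmxA.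
  by case: uU => -> _; rewrite mul1mx.
have Mmax x : cnorm2 (M *m x) <= sg ^+ 2 * cnorm2 x.
  rewrite MM -!mulmxA (cnorm2_unitary _ _ (qunitary_adjoint _ uU)).
  by rewrite sg2 (le_trans (vmax _))// cnorm2_unitary.
have Mcol i : M i ord0 = if i == ord0 then qreal sg else 0.
  transitivity ((M *m e n) i ord0).
    rewrite mxE (bigD1 ord0)//= big1 => [|k /negPf k0].
      by rewrite mxE !eqxx mulr1 addr0.
    by rewrite mxE k0 mulr0.
  rewrite Me !mxE eqxx andbT; case: eqP => _; last by rewrite mulr0.
  by rewrite mulr1.
have Mrow j : j != ord0 -> M ord0 j = 0.
  move=> j0; apply: qnorm2_eq0.
  (* The test vector is the adjoint of the first row [r]. It gives [|r|^4 <= |M x|^2 <= sg^2 |r|^2],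
     hence [|r|^2 <= sg^2], while the first entry of [r] already contributes [sg^2]. *)
  pose x : 'cV[quat R]_(1 + n) := qadjoint (row ord0 M).
  have xE : cnorm2 x = \sum_k qnorm2 (M ord0 k).
    by apply: eq_bigr => k _; rewrite !mxE qnorm2_conj.
  have x0 : (M *m x) ord0 ord0 = qreal (cnorm2 x).
    rewrite mxE xE qreal_sum; apply: eq_bigr => k _.
    by rewrite !mxE -{1}(qconjK (M ord0 k)) qmul_conj qnorm2_conj.
  have Mx := Mmax x.
  have Mx0 : cnorm2 x ^+ 2 <= cnorm2 (M *m x).
    rewrite /cnorm2 -/(cnorm2 x) (bigD1 ord0)//= x0 qnorm2_real lerDl.
    by rewrite sumr_ge0// => k _; exact: qnorm2_ge0.
  have xs : sg ^+ 2 + qnorm2 (M ord0 j) <= cnorm2 x.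
    rewrite xE (bigD1 ord0)//= (bigD1 j)//= Mcol eqxx qnorm2_real lerD2l lerDl.
    by rewrite sumr_ge0// => k _; exact: qnorm2_ge0.
  have := qnorm2_ge0 (M ord0 j); have := cnorm2_ge0 x; have := sqr_ge0 sg.
  move: (qnorm2 _) (cnorm2 x) (sg ^+ 2) (cnorm2 (M *m x)) Mx Mx0 xs => q X S C.
  move=> CX XC SX S0 X0 q0; apply/eqP; rewrite eq_le q0 andbT leNgt.
  apply/negP => qpos; have Xpos : 0 < X by lra.
  have : X * X <= S * X by rewrite -expr2 (le_trans XC).
  by rewrite ler_pM2r//; lra.
pose B : 'M[quat R]_(m, n) := drsubmx M.
have lE k : lshift k ord0 = ord0 :> 'I_(1 + k) by exact: val_inj.
have ME : M = block_mx (qreal sg)%:M 0 0 B.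
  rewrite -[LHS]submxK; congr block_mx.
  - by apply/matrixP => i j; rewrite !ord1 !mxE !lE Mcol mulr1n eqxx.
  - by apply/matrixP => i j; rewrite !ord1 !mxE lE Mrow// -val_eqE.
  - by apply/matrixP => i j; rewrite !ord1 !mxE lE Mcol -val_eqE.
have [s hs] := IH _ B; have [ss sorts s0 [U' [V' [uU' uV' eB]]]] := hs.
exists (sg :: s); split.
- by rewrite /= ss minnSS.
- case: s ss sorts s0 {eB} hs => //= s1 s ss -> /andP[s10 _] hs; rewrite andbT.
  have /andP[mn0 mn1] : (0 < m)%N && (0 < n)%N by rewrite -leq_min -ss.
  (* The top singular value of [B] is attained at a unit [y]; maximality of [sg], tested on [y]
     padded by 0, gives [s1 <= sg]. *)
  have [y y1 By] := singular_value_attained _ _ 0 hs mn1 mn0.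
  have := Mmax (col_mx 0 y); rewrite ME mul_block_col !(mulmx0, mul0mx) !add0r.
  rewrite !cnorm2_col_mx !cnorm20 !add0r y1 mulr1 By.
  by rewrite ler_sqr ?nnegrE ?sqrtr_ge0.
- by rewrite /= sqrtr_ge0.
pose U2 : 'M[quat R]_(1 + m) := block_mx (1%:M : 'M[quat R]_1) 0 0 U'.
pose V2 : 'M[quat R]_(1 + n) := block_mx (1%:M : 'M[quat R]_1) 0 0 V'.
have key : qadjoint U2 *m M *m V2 =
    block_mx (qreal sg)%:M 0 0 (qadjoint U' *m B *m V').
  rewrite /U2 qadjoint_block !qadjoint0 qadjoint_scalar qconj1 ME /V2 !mulmx_block.
  by rewrite !(mulmx0, mul0mx, mulmx1, mul1mx, addr0, add0r).
exists (U *m U2), (V *m V2); split.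
- exact: qunitaryM uU (qunitary_block _ uU').
- exact: qunitaryM uV (qunitary_block _ uV').
transitivity (qadjoint U2 *m M *m V2); first by rewrite qadjointM MM !mulmxA.
have entry (i : 'I_(1 + m)) (j : 'I_(1 + n)) :
    block_mx (qreal sg)%:M 0 0 (qadjoint U' *m B *m V') i j =
    if i == j :> nat then qreal (sg :: s)`_i else 0.
  rewrite eB; case: (split_ordP i) => k ->; case: (split_ordP j) => l ->.
  - by rewrite block_mxEul !ord1 mxE eqxx mulr1n.
  - by rewrite block_mxEur mxE !ord1.
  - by rewrite block_mxEdl mxE !ord1.
  - by rewrite block_mxEdr mxE /= eqSS.
by rewrite key; apply/matrixP => i j; rewrite [RHS]mxE; exact: entry.
Qed.

Lemma singular_valuesP {R : realType} {m n} (A : 'M[quat R]_(m, n)) :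
  is_singular_values A (singular_values A).
Proof.
by have [s sP] := singular_values_exist A; apply: (xgetPex [::]); exists s.
Qed.

Lemma singular_values_order {R : realType} {m n} (A : 'M[quat R]_(m, n)) j k :
  (j <= k < n)%N -> (n <= m)%N ->
  0 <= (singular_values A)`_k <= (singular_values A)`_j.
Proof.
move=> /andP[jk kn] nm; have [ss sorts s0 _] := singular_valuesP A.
have sn : size (singular_values A) = n by rewrite ss; apply/minn_idPr.
apply/andP; split; first by apply: (all_nthP 0 s0); rewrite sn.
have tr : transitive (fun a b : R => b <= a) by move=> a b c ab bc; exact: le_trans bc ab.
have := sorted_leq_nth tr (fun a => lexx a) 0 sorts.
by apply => //; rewrite inE sn// (leq_ltn_trans jk).
Qed.

Lemma sigma_min_le_max {R : realType} {m n} (A : 'M[quat R]_(m, n)) :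
  (0 < n)%N -> (n <= m)%N -> 0 <= sigma_min A <= sigma_max A.
Proof.
by move=> n0 nm; apply: singular_values_order => //; rewrite prednK ?leqnn.
Qed.

(** One direction tests the last right singular vector, the other bounds every weight [s_j^2] below
    by [b^2]; with [n <= m] every coordinate carries a weight. *)
Lemma sigma_min_geP {R : realType} {m n} (A : 'M[quat R]_(m, n)) (b : R) :
  (0 < n)%N -> (n <= m)%N -> 0 <= b ->
  (forall x, b ^+ 2 * cnorm2 x <= cnorm2 (A *m x)) <-> b <= sigma_min A.
Proof.
move=> n0 nm b0; have n1 : (n.-1 < n)%N by rewrite prednK.
have /andP[m0 _] := sigma_min_le_max A n0 nm.
split => [bA|bs x].
  have [x x1] := singular_value_attained _ _ n.-1 (singular_valuesP A) n1 (leq_trans n1 nm).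
  move=> Ax; have := bA x; rewrite x1 Ax mulr1.
  by rewrite ler_sqr.
have [V [uV AV]] := cnorm2_singular _ _ (singular_valuesP A).
have -> : x = V *m (qadjoint V *m x) by case: uV => _ uV; rewrite mulmxA uV mul1mx.
rewrite AV cnorm2_unitary// /cnorm2 mulr_sumr [leRHS]big_mkcond; apply: ler_sum => j _.
rewrite (leq_trans _ nm)// ler_wpM2r ?qnorm2_ge0//.
have jn : (j <= n.-1 < n)%N by rewrite n1 andbT -ltnS prednK.
have /andP[_ sj] := singular_values_order A j n.-1 jn nm.
have bj : b <= (singular_values A)`_j := le_trans bs sj.
by rewrite ler_sqr ?nnegrE//; exact: le_trans b0 bj.
Qed.

Lemma sigma_max_leP {R : realType} {m n} (A : 'M[quat R]_(m, n)) (a : R) :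
  (0 < n)%N -> (n <= m)%N -> 0 <= a ->
  (forall x, cnorm2 (A *m x) <= a ^+ 2 * cnorm2 x) <-> sigma_max A <= a.
Proof.
move=> n0 nm a0; have /andP[m0 mM] := sigma_min_le_max A n0 nm.
have M0 := le_trans m0 mM.
split => [aA|sa x].
  have [x x1] := singular_value_attained _ _ 0 (singular_valuesP A) n0 (leq_trans n0 nm).
  move=> Ax; have := aA x; rewrite x1 Ax mulr1.
  by rewrite ler_sqr.
have [V [uV AV]] := cnorm2_singular _ _ (singular_valuesP A).
have -> : x = V *m (qadjoint V *m x) by case: uV => _ uV; rewrite mulmxA uV mul1mx.
rewrite AV cnorm2_unitary// /cnorm2 mulr_sumr [leLHS]big_mkcond; apply: ler_sum => j _.
rewrite (leq_trans _ nm)// ler_wpM2r ?qnorm2_ge0//.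
have /andP[s0 sj] := singular_values_order A 0 j (ltn_ord j) nm.
by rewrite ler_sqr ?nnegrE//; exact: le_trans sj sa.
Qed.

(** * Products of independent variables *)

(** The hypothesis on [G] encodes its independence from [f], with [c] the mean of [G]; it is applied
    to each of the finitely many level sets of [phi]. *)
Lemma integral_comp_nnsfun {d} {T : measurableType d} {R : realType}
    (P : probability T R) (phi : {nnsfun R >-> R}) (f G : T -> R) (c : \bar R) :
  measurable_fun setT f -> measurable_fun setT G -> (forall w, 0 <= G w) ->
  (forall C : set R, measurable C ->
    (\int[P]_w (G w * \1_C (f w))%:E = c * P (f @^-1` C))%E) ->
  (\int[P]_w (G w * phi (f w))%:E =
   \sum_(y \in range phi) y%:E * (c * P (f @^-1` (phi @^-1` [set y]))))%E.
Proof.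
move=> mf mG G0 GC.
have mC y : measurable (phi @^-1` [set y]) by [].
have m1 y : measurable_fun setT (fun w => \1_(phi @^-1` [set y]) (f w) : R).
  apply: (measurable_indic (U := f @^-1` (phi @^-1` [set y]))).
  by rewrite -[X in measurable X]setTI; exact: mf.
under eq_integral => w _.
  rewrite (fimfunE phi) EFinM -fsumEFin// ge0_mule_fsumr; last first.
    by move=> y; exact: nnfun_muleindic_ge0.
  over.
rewrite ge0_integral_fsum//=; last 2 first.
- move=> y; apply/measurable_EFinP; apply: measurable_funM => //.
  exact: measurable_funM.
- by move=> y w _; rewrite mule_ge0 ?lee_fin//; exact: nnfun_muleindic_ge0.
apply: eq_fsbigr => y /[!inE] -[x _ <-].
rewrite -GC// -ge0_integralZl//=.
- by apply: eq_integral => w _; rewrite -!EFinM mulrCA.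
- by apply/measurable_EFinP; exact: measurable_funM.
- by move=> w _; rewrite lee_fin mulr_ge0.
- by rewrite lee_fin.
Qed.

(** Approximating on the real line and composing with [f] keeps the approximants functions of [f],
    to which the hypothesis on indicators applies; monotone convergence does the rest. *)
Lemma integral_factor {d} {T : measurableType d} {R : realType}
    (P : probability T R) (f G : T -> R) (c : \bar R) :
  measurable_fun setT f -> measurable_fun setT G -> (forall w, 0 <= G w) ->
  (forall w, 0 <= f w) -> (0 <= c)%E -> c \is a fin_num ->
  (forall C : set R, measurable C ->
    (\int[P]_w (G w * \1_C (f w))%:E = c * P (f @^-1` C))%E) ->
  (\int[P]_w (G w * f w)%:E = c * \int[P]_w (f w)%:E)%E.
Proof.
move=> mf mG G0 f0 c0 cfin GC.
(* Approximation by nonnegative simple functions needs a nonnegative target; [|x|] equals [x] at the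
   values of [f]. *)
have mN : measurable_fun setT (fun x : R => `|x|%:E).
  by apply/measurable_EFinP; exact: normr_measurable.
pose phi n := nnsfun_approx measurableT mN n.
have phif w : (phi n (f w))%:E @[n --> \oo] --> (f w)%:E.
  have := cvg_nnsfun_approx measurableT mN (fun x _ => normr_ge0 x) (x := f w) I.
  by rewrite ger0_norm.
have mphi n : measurable_fun setT (fun w => phi n (f w)) by exact: measurableT_comp.
have phi_nd w : {homo (fun n => phi n (f w)) : n m / (n <= m)%N >-> n <= m}.
  by move=> n m nm; have /lefP := nd_nnsfun_approx measurableT mN nm; exact.
have cvgH (H : T -> R) : measurable_fun setT H -> (forall w, 0 <= H w) ->
    (\int[P]_w (H w * phi n (f w))%:E)%E @[n --> \oo] -->
    (\int[P]_w (H w * f w)%:E)%E.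
  move=> mH H0.
  rewrite [X in _ --> X](_ : _ =
      \int[P]_w limn (fun n => (H w * phi n (f w))%:E))%E; last first.
    apply: eq_integral => w _; apply/esym/cvg_lim => //.
    under eq_fun do rewrite EFinM.
    rewrite EFinM; apply: cvgeZl => //.
  apply: cvg_monotone_convergence => //.
  - by move=> n; apply/measurable_EFinP; exact: measurable_funM.
  - by move=> n w _; rewrite lee_fin mulr_ge0.
  - by move=> w _ n m nm; rewrite lee_fin ler_wpM2l//; exact: phi_nd.
have m1 : measurable_fun setT (cst 1 : T -> R) by exact: measurable_cst.
have c1 := cvgH G mG G0; have c2 := cvgH (cst 1) m1 (fun=> ler01).
have e n : (\int[P]_w (G w * phi n (f w))%:E =
    c * \int[P]_w (cst 1 w * phi n (f w))%:E)%E.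
  rewrite (integral_comp_nnsfun P (phi n) f G c)//.
  (* The case [G = 1], [c = 1] of the same expansion evaluates the integral of [phi n (f w)]. *)
  have one (C : set R) : measurable C ->
      (\int[P]_w (cst 1 w * \1_C (f w))%:E = 1 * P (f @^-1` C))%E.
    move=> mC; rewrite mul1e -[X in P X]setIT -integral_indic//.
      by apply: eq_integral => w _; rewrite mul1r.
    by rewrite -[X in measurable X]setTI; exact: mf.
  rewrite (integral_comp_nnsfun P (phi n) f (cst 1) 1%E)//.
  rewrite ge0_mule_fsumr; first by apply: eq_fsbigr => y _; rewrite mul1e muleCA.
  move=> y; have [y0|y0] := ltP y 0; last by rewrite mul1e mule_ge0// lee_fin.
  by rewrite preimage_nnfun0// preimage_set0 measure0 mule0 mule0.
rewrite (_ : (fun n => _) = fun n =>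
  (c * \int[P]_w (cst 1 w * phi n (f w))%:E)%E) in c1; last exact/funext.
have := cvg_unique _ c1 (cvgeZl cfin c2) => /(_ (@ereal_hausdorff R)) ->.
by congr (_ * _)%E; apply: eq_integral => w _; rewrite mul1r.
Qed.

Lemma measurable_preimageT {d d'} {T : measurableType d} {U : measurableType d'}
    (f : T -> U) (B : set U) :
  measurable_fun setT f -> measurable B -> measurable (f @^-1` B).
Proof. by move=> mf mB; rewrite -[X in measurable X]setTI; exact: mf. Qed.

Lemma integral_prod_independent {d} {T : measurableType d} {R : realType}
    (P : probability T R) {I : finType} (Y : I -> T -> R) (e : I -> R) :
  (forall i, measurable_fun setT (Y i)) -> (forall i w, 0 <= Y i w) ->
  (forall i, \int[P]_w (Y i w)%:E = (e i)%:E)%E ->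
  (forall (J : {set I}) (B : I -> set R), (forall i, measurable (B i)) ->
    P [set w | forall i, i \in J -> B i (Y i w)] =
    (\prod_(i in J) P [set w | B i (Y i w)])%E) ->
  (\int[P]_w (\prod_i Y i w)%:E = (\prod_i e i)%:E)%E.
Proof.
move=> mY Y0 Ye ind.
pose E (J : {set I}) (B : I -> set R) := [set w | forall i, i \in J -> B i (Y i w)].
have mE J B : (forall i, measurable (B i)) -> measurable (E J B).
  move=> mB.
  rewrite (_ : E J B = \bigcap_(i in [set` J]) (Y i @^-1` B i))//.
  apply: fin_bigcap_measurable; first exact: finite_finset.
  by move=> i _; exact: measurable_preimageT.
have e0 i : 0 <= e i.
  by rewrite -lee_fin -Ye integral_ge0// => w _; rewrite lee_fin.
(* The event [E J B] on variables outside [r] is carried along because [integral_factor] tests the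
   next variable against a Borel set; such a test becomes one more index in [J]. *)
suff key (r : seq I) : uniq r -> forall (J : {set I}) B,
    (forall i, i \in r -> i \notin J) -> (forall i, measurable (B i)) ->
    (\int[P]_w ((\prod_(i <- r) Y i w) * \1_(E J B) w)%:E =
     (\prod_(i <- r) e i)%:E * P (E J B))%E.
  have := key (index_enum I) (index_enum_uniq I) finset.set0 (fun=> setT).
  have -> : E finset.set0 (fun=> setT) = setT by apply/seteqP; split.
  rewrite probability_setT mule1 => <- //; last by move=> i _; rewrite inE.
  by apply: eq_integral => w _; rewrite indicT mulr1.
elim: r => [_ J B _ mB|k r IH /= /andP[kr ur] J B rJ mB].
  under eq_integral do rewrite big_nil mul1r.
  by rewrite big_nil mul1e integral_indic ?setIT//; exact: mE.
have kJ : k \notin J by rewrite rJ// mem_head.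
pose G w := (\prod_(i <- r) Y i w) * \1_(E J B) w.
have mG : measurable_fun setT G.
  apply: measurable_funM; first by apply: measurable_prod => i _.
  by apply: measurable_indic; exact: mE.
have G0 w : 0 <= G w by rewrite mulr_ge0// prodr_ge0.
have := integral_factor P (Y k) G ((\prod_(i <- r) e i)%:E * P (E J B))%E
  (mY k) mG G0 (Y0 k).
rewrite mule_ge0 ?lee_fin ?prodr_ge0// fin_numM ?fin_num_measure//; last exact: mE.
move=> /(_ isT isT) H.
transitivity (\int[P]_w (G w * Y k w)%:E)%E.
  by apply: eq_integral => w _; congr EFin; rewrite big_cons /G /E; ring.
rewrite H.
  by rewrite Ye big_cons EFinM muleC muleA.
move=> C mC.
pose B' i := if i == k then C else B i.
have mB' i : measurable (B' i) by rewrite /B'; case: eqP.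
have EB' : E (k |: J)%SET B' = E J B `&` (Y k @^-1` C).
  apply/seteqP; split => w.
    move=> h; split => [i iJ|].
      have := h i; rewrite !inE iJ orbT /B' => /(_ isT).
      by case: eqP => // ik; move: iJ; rewrite ik (negPf kJ).
    by have := h k; rewrite !inE eqxx /B' eqxx; exact.
  move=> [h1 h2] i; rewrite !inE /B'; case: eqP => [-> _ //|_ /= iJ].
  exact: h1.
transitivity (\int[P]_w ((\prod_(i <- r) Y i w) * \1_(E (k |: J)%SET B') w)%:E)%E.
  apply: eq_integral => w _; congr EFin; rewrite /G -mulrA; congr (_ * _).
  by rewrite EB' indicI.
rewrite IH//; last first.
  move=> i ir; rewrite !inE negb_or rJ ?inE ?ir ?orbT// andbT.
  by apply: contraNN kr => /eqP <-.
rewrite -muleA; congr (_ * _)%E.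
rewrite /E ind// ind// big_setU1//= muleC; congr (_ * _)%E; last first.
  by rewrite /B' eqxx.
apply: eq_bigr => i iJ; rewrite /B'; case: eqP => // ik.
by move: iJ; rewrite ik (negPf kJ).
Qed.

(** * Exponential moments *)

Lemma expR_nneseries {R : realType} (x : R) :
  (expR x)%:E = (\sum_(0 <= n <oo) (x ^+ n / n`!%:R)%:E)%E.
Proof.
rewrite /expR -EFin_lim; last exact: is_cvg_series_exp_coeff.
by apply/congr_lim/funext => n /=; rewrite sumEFin.
Qed.

(** [1 / (1 + x) <= 1 - x + x^2], since [(1 - x + x^2) (1 + x) = 1 + x^3]. *)
Lemma expRN_le {R : realType} (x : R) : 0 <= x -> expR (- x) <= 1 - x + x ^+ 2.
Proof.
move=> x0; rewrite expRN -[leLHS]mul1r ler_pdivrMr ?expR_gt0//.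
have h := expR_ge1Dx x.
have : 0 <= x ^+ 3 by rewrite exprn_ge0.
have : 0 <= 1 - x + x ^+ 2 by have := sqr_ge0 (x - 1); nra.
move=> h1 h3; have := ler_wpM2l h1 h; have -> : (1 - x + x ^+ 2) * (1 + x) = 1 + x ^+ 3.
  by ring.
by lra.
Qed.

Section MGF.
Context {d} {T : measurableType d} {R : realType} (P : probability T R).
Context (xi : T -> R) (M : R).
Context (mxi : measurable_fun setT xi).
Context (xi2 : (\int[P]_w (xi w ^+ 2)%:E = 1)%E).
Context (xi_moment : forall p : nat,
  (\int[P]_w (xi w ^+ (2 * p))%:E <= (M ^+ p * p`!%:R)%:E)%E).

Let m2 p : measurable_fun setT (fun w => xi w ^+ p).
Proof. exact: measurable_funX. Qed.

Let xi_ge0 p w : 0 <= xi w ^+ (2 * p).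
Proof. by rewrite exprM exprn_ge0// sqr_ge0. Qed.

Let mexp mu : measurable_fun setT (fun w => expR (mu * xi w ^+ 2)).
Proof.
apply: (measurableT_comp (@measurable_expR R)).
by apply: measurable_funM => //; exact: m2.
Qed.

(** The exponential series is integrated termwise. The linear term is exactly [mu] by the unit
    second moment; the terms from [n = 2] on are at most [(mu * M) ^+ n] and sum to at most twice
    the first of these bounds. *)
Lemma mgf_sqr_ge0 mu : 0 <= mu -> 0 <= M -> mu * M <= 2^-1 ->
  (\int[P]_w (expR (mu * xi w ^+ 2))%:E <=
   (expR (mu + 2 * (mu * M) ^+ 2))%:E)%E.
Proof.
move=> mu0 M0 muM.
under eq_integral do rewrite expR_nneseries.
rewrite integral_nneseries//; last 2 first.
- move=> n; apply/measurable_EFinP; apply: measurable_funM => //.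
  apply: measurable_funX; apply: measurable_funM => //; exact: m2.
- by move=> n w _; rewrite lee_fin divr_ge0// exprn_ge0// mulr_ge0// sqr_ge0.
pose a n := (\int[P]_w ((mu * xi w ^+ 2) ^+ n / n`!%:R)%:E)%E.
pose b n : R := if n is 1%N then mu else (mu * M) ^+ n.
have aE n : a n = ((mu ^+ n / n`!%:R)%:E * \int[P]_w (xi w ^+ (2 * n))%:E)%E.
  rewrite -ge0_integralZl//=.
  - by apply: eq_integral => w _; rewrite -EFinM exprMn -exprM mulrAC.
  - by apply/measurable_EFinP; exact: m2.
  - by move=> w _; rewrite lee_fin.
  - by rewrite lee_fin divr_ge0// exprn_ge0.
have ab n : (a n <= (b n)%:E)%E.
  rewrite aE; have [->|n1] := eqVneq n 1%N.
    by rewrite muln1 xi2 mule1 divr1 expr1.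
  have -> : b n = mu ^+ n / n`!%:R * (M ^+ n * n`!%:R).
    have -> : b n = (mu * M) ^+ n by case: n n1 => [|[|]].
    by rewrite exprMn; field; rewrite pnatr_eq0 -lt0n fact_gt0.
  by rewrite [in leRHS]EFinM lee_wpmul2l// lee_fin divr_ge0// exprn_ge0.
apply: (@le_trans _ _ (1 + mu + 2 * (mu * M) ^+ 2)%:E); last first.
  by rewrite lee_fin -addrA expR_ge1Dx.
have x0 : 0 <= mu * M by rewrite mulr_ge0.
apply: lime_le.
  apply: is_cvg_nneseries => n _ _; rewrite integral_ge0// => w _.
  by rewrite lee_fin divr_ge0// exprn_ge0// mulr_ge0// sqr_ge0.
apply: nearW => n; apply: (@le_trans _ _ (\sum_(0 <= i < n) (b i)%:E)%E).
  by apply: lee_sum => i _; exact: ab.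
rewrite sumEFin lee_fin big_mkord.
have b0 i : 0 <= b i by case: i => [|[|i]] //=; rewrite exprn_ge0.
(* Two more terms guarantee that the summands of index 0 and 1 exist and can be split off. *)
apply: (@le_trans _ _ (\sum_(i < n.+2) b i)).
  rewrite 2!big_ord_recr /= -addrA lerDl.
  by apply: addr_ge0; [exact: (b0 n)|exact: (b0 n.+1)].
rewrite 2!big_ord_recl /= expr0 addrA lerD2l.
under eq_bigr do rewrite /bump /= !add1n 2!exprS mulrA -expr2.
rewrite -mulr_sumr mulrC ler_wpM2r ?sqr_ge0//.
by apply: sum_geometric_le2; rewrite x0.
Qed.

(** For a negative exponent the second-order bound [expRN_le] suffices, so only the fourth moment
    enters and [s] need not be small. The linear term stays on the left until the end, to keep the
    integrands nonnegative. *)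
Lemma mgf_sqr_le0 s : 0 <= s ->
  (\int[P]_w (expR (- s * xi w ^+ 2))%:E <=
   (expR (- s + 2 * (s * M) ^+ 2))%:E)%E.
Proof.
move=> s0.
have h : (\int[P]_w (expR (- s * xi w ^+ 2) + s * xi w ^+ 2)%:E <=
    \int[P]_w (1 + s ^+ 2 * xi w ^+ (2 * 2))%:E)%E.
  apply: ge0_le_integral => //.
  - by move=> w _; rewrite lee_fin addr_ge0 ?expR_ge0// mulr_ge0// sqr_ge0.
  - apply/measurable_EFinP; apply: measurable_funD => //.
    by apply: measurable_funM => //; exact: m2.
  - apply/measurable_EFinP; apply: measurable_funD => //.
    by apply: measurable_funM => //; exact: m2.
  - move=> w _; rewrite lee_fin mulNr.
    have := expRN_le (s * xi w ^+ 2); rewrite mulr_ge0 ?sqr_ge0// => /(_ isT).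
    by rewrite exprMn -exprM; lra.
have intZ (k : R) p : 0 <= k -> (\int[P]_w (k * xi w ^+ (2 * p))%:E =
    k%:E * \int[P]_w (xi w ^+ (2 * p))%:E)%E.
  move=> k0; under eq_integral do rewrite EFinM.
  rewrite ge0_integralZl//=; first by apply/measurable_EFinP; exact: m2.
  by move=> w _; rewrite lee_fin.
have mZ (k : R) p : measurable_fun setT (fun w => (k * xi w ^+ (2 * p))%:E).
  by apply/measurable_EFinP; apply: measurable_funM => //; exact: m2.
have e1 : (\int[P]_w (expR (- s * xi w ^+ 2) + s * xi w ^+ 2)%:E =
    \int[P]_w (expR (- s * xi w ^+ 2))%:E + s%:E)%E.
  under eq_integral do rewrite EFinD.
  rewrite ge0_integralD//=.
  - by rewrite (intZ s 1%N)// xi2 mule1.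
  - by apply/measurable_EFinP.
  - by move=> w _; rewrite lee_fin mulr_ge0// sqr_ge0.
  - exact: (mZ s 1%N).
have e2 : (\int[P]_w (1 + s ^+ 2 * xi w ^+ (2 * 2))%:E =
    1 + (s ^+ 2)%:E * \int[P]_w (xi w ^+ (2 * 2))%:E)%E.
  under eq_integral do rewrite EFinD.
  rewrite ge0_integralD//=.
  - by rewrite integral_cst//= probability_setT mule1 intZ// sqr_ge0.
  - by move=> w _; rewrite lee_fin mulr_ge0// sqr_ge0.
rewrite e1 e2 in h.
have h2 : (\int[P]_w (expR (- s * xi w ^+ 2))%:E + s%:E <=
    (1 + s ^+ 2 * (M ^+ 2 * 2`!%:R))%:E)%E.
  apply: le_trans h _; rewrite EFinD leeD2l// [in leRHS]EFinM lee_wpmul2l//.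
  by rewrite lee_fin sqr_ge0.
rewrite -leeBrDr// -EFinB in h2; apply: le_trans h2 _; rewrite lee_fin.
have := expR_ge1Dx (- s + 2 * (s * M) ^+ 2); rewrite exprMn (_ : 2`! = 2%N)//.
lra.
Qed.
End MGF.

(** The exponent [2 p] in the supremum gives [E xi^(2p) <= K^(2p) (2p)^p], and [p^p <= e^p p!] by
    one term of the exponential series. *)
Lemma psi2_norm_moment {d} {T : measurableType d} {R : realType}
    (P : probability T R) (xi : T -> R) (K : R) :
  0 < K -> (psi2_norm P xi <= K%:E)%E ->
  forall p, (\int[P]_w (xi w ^+ (2 * p))%:E <=
             ((2 * expR 1 * K ^+ 2) ^+ p * p`!%:R)%:E)%E.
Proof.
move=> K0 xiK p; have [->|p0] := posnP p.
  rewrite muln0; under eq_integral do rewrite expr0.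
  by rewrite integral_cst//= probability_setT mule1 expr0 mul1r.
pose q : R := (2 * p)%:R.
have q1 : 1 <= q by rewrite ler1n muln_gt0.
have q0 : 0 < q by rewrite (lt_le_trans ltr01).
have := le_trans (ereal_sup_ubound _) xiK => H.
have {H} : ((q `^ (- 2^-1))%:E * poweR ('E_P[fun w => (`|xi w| `^ q)%R]) q^-1
    <= K%:E)%E by apply: H; exists q.
have -> : ('E_P[fun w => (`|xi w| `^ q)%R] = \int[P]_w (xi w ^+ (2 * p))%:E)%E.
  rewrite unlock; apply: eq_integral => w _.
  by rewrite /q powR_mulrn// exprM exprM real_normK// num_real.
have : (0 <= \int[P]_w (xi w ^+ (2 * p))%:E)%E.
  by apply: integral_ge0 => w _; rewrite lee_fin exprM exprn_ge0// sqr_ge0.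
(* An infinite moment would make the norm infinite. *)
case: (integral _ _ _) => [r||] //; last first.
  move=> _; rewrite /= invr_eq0 gt_eqF// gt0_muley ?lte_fin ?powR_gt0//.
rewrite lee_fin => r0; rewrite poweR_EFin -EFinM !lee_fin powRN powR12_sqrt; last exact: ltW.
rewrite (mulrC (Num.sqrt q)^-1) ler_pdivrMr ?sqrtr_gt0// => h.
have : (r `^ q^-1) ^+ (2 * p) <= (K * Num.sqrt q) ^+ (2 * p).
  by apply: lerXn2r => //; rewrite nnegrE ?powR_ge0// mulr_ge0 ?sqrtr_ge0// (ltW K0).
rewrite -powR_mulrn ?powR_ge0// -/q -powRrM mulVf ?gt_eqF// powRr1// => /le_trans.
apply; rewrite exprMn exprM (exprM (Num.sqrt q)) (sqr_sqrtr (ltW q0)).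
have -> : (2 * expR 1 * K ^+ 2) ^+ p * p`!%:R =
    (K ^+ 2) ^+ p * (2 ^+ p * (expR 1 ^+ p * p`!%:R)).
  by rewrite (exprMn p (2 * _)) (exprMn p 2) (mulrC _ ((K ^+ 2) ^+ p)) !mulrA.
apply: ler_wpM2l; first by rewrite exprn_ge0// sqr_ge0.
rewrite /q natrM exprMn ler_wpM2l ?exprn_ge0// -expRM_natl mulr1.
rewrite -ler_pdivrMr ?ltr0n ?fact_gt0//.
have := expR_ge1Dxn p.-1 (ler0n R p); rewrite prednK// => h2.
by apply: le_trans h2; rewrite lerDr.
Qed.

(** Integrating the double sum termwise needs integrable products; these are dominated by sums of
    squares, whose integrals are diagonal entries of the identity. *)
Lemma isotropic_second_moment {d} {T : measurableType d} {R : realType}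
    (P : probability T R) (m : nat) (V : T -> 'cV[R]_m) (u : 'cV[R]_m) :
  (forall k, measurable_fun setT (fun w => V w k ord0)) ->
  (forall k l, 'E_P[fun w => ((V w *m (V w)^T) k l)%R] =
     ((1%:M : 'M[R]_m) k l)%:E)%E ->
  dotv u u = 1 -> (\int[P]_w (dotv (V w) u ^+ 2)%:E = 1)%E.
Proof.
move=> mV iV u1.
have VV w k l : (V w *m (V w)^T) k l = V w k ord0 * V w l ord0.
  by rewrite mxE big_ord1 mxE.
have E k l : (\int[P]_w (V w k ord0 * V w l ord0)%:E = (k == l)%:R%:E)%E.
  have := iV k l; rewrite unlock mxE => <-.
  by apply: eq_integral => w _; rewrite VV.
have intsq k : P.-integrable setT (fun w => (V w k ord0 ^+ 2)%:E).
  apply/integrableP; split; first by apply/measurable_EFinP; exact: measurable_funX.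
  under eq_integral do rewrite gee0_abs ?lee_fin ?sqr_ge0// expr2.
  by rewrite E ltry.
have intkl k l : P.-integrable setT (fun w => (V w k ord0 * V w l ord0)%:E).
  apply: (le_integrable _ _ _ (integrableD _ (intsq k) (intsq l))) => //.
    by apply/measurable_EFinP; exact: measurable_funM.
  move=> w _; rewrite -EFinD /= lee_fin [in leRHS]ger0_norm ?addr_ge0 ?sqr_ge0//.
  by rewrite ler_norml; apply/andP; split; nra.
have intu k l : P.-integrable setT
    (fun w => (u k ord0 * u l ord0)%:E * (V w k ord0 * V w l ord0)%:E)%E.
  exact: integrableZl.
transitivity (\int[P]_w (\sum_k \sum_l
    (u k ord0 * u l ord0)%:E * (V w k ord0 * V w l ord0)%:E))%E.
  apply: eq_integral => w _; under eq_bigr do under eq_bigr do rewrite -EFinM.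
  under eq_bigr do rewrite sumEFin.
  rewrite sumEFin; congr EFin; rewrite expr2 dotvE mulr_suml.
  apply: eq_bigr => k _; rewrite mulr_sumr; apply: eq_bigr => l _; ring.
rewrite integral_sum//; last by move=> k; exact: integrable_sum.
transitivity (\sum_k (u k ord0 * u k ord0)%:E)%E; last first.
  by rewrite sumEFin -dotvE u1.
apply: eq_bigr => k _; rewrite integral_sum// (bigD1 k)//= big1.
  by rewrite integralZl// E eqxx mule1 adde0.
by move=> l /negPf lk; rewrite integralZl// E eq_sym lk mule0.
Qed.

(** Independence is tested on sets generated by the opens of the vector space, real random variables
    on sets generated by rays; the preimage of an open ray is open. *)
Lemma borel_preimage {R : realType} {X : topologicalType} (h : X -> R) (B : set R) :
  continuous h -> measurable B -> <<s @open X >> (h @^-1` B).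
Proof.
move=> ch mB.
have {}mB : <<s @RGenOInfty.G R >> B.
  by have : (@RGenOInfty.G R).-sigma.-measurable B by rewrite -RGenOInfty.measurableE.
rewrite -[h @^-1` B]setTI.
have : sigma_algebra setT (image_set_system setT h <<s @open X >>).
  by apply: sigma_algebra_image; exact: smallest_sigma_algebra.
move=> sa; apply: (smallest_sub sa _ mB).
move=> _ [x ->]; rewrite /image_set_system /= setTI.
apply: sub_sigma_algebra; apply: open_comp => //; exact: interval_open.
Qed.

Lemma continuous_dotv {R : realType} {m} (u : 'cV[R]_m) :
  continuous (fun v : 'cV[R]_m => dotv v u).
Proof.
rewrite (_ : (fun v => _) = fun v : 'cV[R]_m => \sum_i v i ord0 * u i ord0); last first.
  by apply/funext => v; rewrite dotvE.
apply: continuous_sum => i v.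
apply: (@continuousM R _ (fun v : 'cV[R]_m => v i ord0) (cst (u i ord0))).
  exact: coord_continuous.
exact: cst_continuous.
Qed.

Lemma measurable_dotv {d} {T : measurableType d} {R : realType} {m}
    (V : T -> 'cV[R]_m) (u : 'cV[R]_m) :
  (forall k, measurable_fun setT (fun w => V w k ord0)) ->
  measurable_fun setT (fun w => dotv (V w) u).
Proof.
move=> mV; rewrite (_ : (fun w => _) = fun w => \sum_i V w i ord0 * u i ord0).
  by apply: measurable_sum => i; exact: measurable_funM.
by apply/funext => w; rewrite dotvE.
Qed.

(** The arithmetic-geometric mean inequality for the four numbers [expR (x c)]. *)
Lemma expR_sum4_le {R : realType} (x : 'I_4 -> R) :
  expR (\sum_c x c) <= 4^-1 * \sum_c expR (4 * x c).
Proof.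
rewrite expR_sum; under [in leRHS]eq_bigr do rewrite expRM_natl.
rewrite !big_ord_recl !big_ord0 /=.
move: (expR_ge0 (x ord0)) (expR_ge0 (x (lift ord0 ord0))).
move: (expR_ge0 (x (lift ord0 (lift ord0 ord0)))).
move: (expR_ge0 (x (lift ord0 (lift ord0 (lift ord0 ord0))))).
move: (expR _) (expR _) (expR _) (expR _) => e3 e2 e1 e0 p3 p2 p1 p0.
have h1 := sqr_ge0 (e0 * e1 - e2 * e3).
have h2 := sqr_ge0 (e0 ^+ 2 - e1 ^+ 2); have h3 := sqr_ge0 (e2 ^+ 2 - e3 ^+ 2).
by lra.
Qed.

(** * Chernoff bound for a sum over independent rows *)

Section Deviation.
Context {d} {T : measurableType d} {R : realType} (P : probability T R).
Context {N m : nat} (V : 'I_N -> T -> 'cV[R]_m) (u : 'I_4 -> 'cV[R]_m) (M : R).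
Context (mV : forall i k, measurable_fun setT (fun w => V i w k ord0)).
Context (indV : mutually_independent P V).
Context (V2 : forall i c, (\int[P]_w (dotv (V i w) (u c) ^+ 2)%:E = 1)%E).
Context (Vp : forall i c p,
  (\int[P]_w (dotv (V i w) (u c) ^+ (2 * p))%:E <= (M ^+ p * p`!%:R)%:E)%E).
Context (M1 : 1 <= M).

Let Z i w := \sum_c dotv (V i w) (u c) ^+ 2.

Let mZ i : measurable_fun setT (Z i).
Proof.
by apply: measurable_sum => c; apply: measurable_funX; exact: measurable_dotv.
Qed.

Let mE l i : measurable_fun setT (fun w => expR (l * (Z i w - 4))).
Proof.
apply: (measurableT_comp (@measurable_expR R)); apply: measurable_funM => //.
exact: measurable_funB.
Qed.

(** [expR_sum4_le] reduces the row to single squares with parameter [4 * l], each costing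
    [2 (4 l M)^2 = 32 (l M)^2]; centring at the mean 4 cancels the linear term [4 * l]. *)
Lemma mgf_row i l : 4 * `|l| * M <= 2^-1 ->
  (\int[P]_w (expR (l * (Z i w - 4)))%:E <= (expR (32 * (l * M) ^+ 2))%:E)%E.
Proof.
move=> lM; pose xi c w := dotv (V i w) (u c).
have mxi c : measurable_fun setT (xi c) by exact: measurable_dotv.
have mexi c : measurable_fun setT (fun w => expR (4 * l * xi c w ^+ 2)).
  apply: (measurableT_comp (@measurable_expR R)); apply: measurable_funM => //.
  exact: measurable_funX.
have one c : (\int[P]_w (expR (4 * l * xi c w ^+ 2))%:E <=
    (expR (4 * l + 32 * (l * M) ^+ 2))%:E)%E.
  have -> : 32 * (l * M) ^+ 2 = 2 * (`|4 * l| * M) ^+ 2.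
    by rewrite [in RHS]exprMn real_normK ?num_real//; ring.
  have M0 : 0 <= M := le_trans ler01 M1.
  have [l0|l0] := leP 0 l.
    rewrite ger0_norm ?mulr_ge0//; apply: mgf_sqr_ge0 => //.
    - exact: V2.
    - exact: Vp.
    - by rewrite mulr_ge0.
    - by rewrite -(ger0_norm l0).
  have := mgf_sqr_le0 P (xi c) M (mxi c) (V2 i c) (Vp i c) (- (4 * l)).
  by rewrite opprK ler0_norm; [apply; lra|lra].
apply: (@le_trans _ _ (\int[P]_w
    ((4^-1 * expR (- (4 * l)))%:E * \sum_c (expR (4 * l * xi c w ^+ 2))%:E))%E).
  apply: ge0_le_integral => //.
  - exact/measurable_EFinP.
  - apply: emeasurable_funM => //; apply: emeasurable_sum => c.
    exact/measurable_EFinP.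
  - move=> w _; rewrite sumEFin -EFinM lee_fin mulrBr expRD.
    rewrite /Z mulr_sumr (le_trans (ler_wpM2r (expR_ge0 _) (expR_sum4_le _)))//.
    rewrite mulrAC (mulrC l 4); apply: ler_wpM2l.
      by rewrite mulr_ge0// expR_ge0.
    by apply: ler_sum => c _; rewrite mulrA.
rewrite ge0_integralZl//=; last 2 first.
- by apply: emeasurable_sum => c; exact/measurable_EFinP.
- by move=> w _; rewrite sumEFin lee_fin sumr_ge0// => c _; exact: expR_ge0.
rewrite ge0_integral_sum//=; last by move=> c; exact/measurable_EFinP.
apply: (@le_trans _ _ ((4^-1 * expR (- (4 * l)))%:E *
    \sum_(c < 4) (expR (4 * l + 32 * (l * M) ^+ 2))%:E)%E).
  apply: lee_wpmul2l; first by rewrite lee_fin mulr_ge0// expR_ge0.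
  by apply: lee_sum => c _; exact: one.
rewrite sumEFin -EFinM lee_fin sumr_const card_ord expRD -(mulr_natl (expR _ * _)).
rewrite [leLHS](_ : _ = expR (- (4 * l)) * expR (4 * l) * expR (32 * (l * M) ^+ 2)).
  by rewrite -expRD addNr expR0 mul1r.
by field.
Qed.

Lemma mgf_sum l : 4 * `|l| * M <= 2^-1 ->
  (\int[P]_w (expR (l * (\sum_i Z i w - 4 * N%:R)))%:E <=
   (expR (32 * (l * M) ^+ 2 * N%:R))%:E)%E.
Proof.
move=> lM.
pose Y i w := expR (l * (Z i w - 4)).
pose e i := fine (\int[P]_w (Y i w)%:E)%E.
have Y0 i w : 0 <= Y i w by exact: expR_ge0.
have eE i : (\int[P]_w (Y i w)%:E = (e i)%:E)%E.
  rewrite fineK// ge0_fin_numE; first exact: le_lt_trans (mgf_row i l lM) (ltry _).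
  by apply: integral_ge0 => w _; rewrite lee_fin.
have e0 i : 0 <= e i.
  by rewrite -lee_fin -eE; apply: integral_ge0 => w _; rewrite lee_fin.
have := integral_prod_independent P Y e (mE l) Y0 eE.
have ind (J : {set 'I_N}) (B : 'I_N -> set R) : (forall i, measurable (B i)) ->
    P [set w | forall i, i \in J -> B i (Y i w)] =
    (\prod_(i in J) P [set w | B i (Y i w)])%E.
  move=> mB.
  (* [Y i] is a continuous function of the row vector, so its Borel events are Borel events of the
     row. *)
  pose q (v : 'cV[R]_m) := \sum_c dotv v (u c) ^+ 2.
  have cd c : continuous (fun v : 'cV[R]_m => dotv v (u c) ^+ 2).
    pose f (v : 'cV[R]_m) := dotv v (u c).
    rewrite (_ : (fun v => _) = f \* f); last by apply/funext => v; rewrite expr2.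
    by move=> v; apply: continuousM; exact: continuous_dotv.
  have cq : continuous q by apply: continuous_sum => c; exact: cd.
  pose g (v : 'cV[R]_m) := l * (q v - 4).
  have cg : continuous g.
    move=> v; apply: (@continuousM R _ (cst l) (fun v => q v - 4)).
      exact: cst_continuous.
    apply: (@continuousB R _ _ q (cst 4)); first exact: cq.
    exact: cst_continuous.
  apply: (indV J (fun i => (expR \o g) @^-1` B i)) => i; apply: borel_preimage => //.
  by move=> v; apply: (@continuous_comp _ _ _ g (@expR R)); [exact: cg|exact: continuous_expR].
move=> /(_ ind) intY.
apply: (@le_trans _ _ (\int[P]_w (\prod_i Y i w)%:E)%E).
  rewrite le_eqVlt; apply/orP; left; apply/eqP;
  apply: eq_integral => w _; congr EFin; rewrite -expR_sum.
  rewrite -mulr_sumr sumrB sumr_const card_ord; congr (expR (l * (_ - _))).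
  by rewrite mulr_natr.
rewrite intY lee_fin mulrC expRM_natl.
rewrite -[X in _ ^+ X](card_ord N) -prodr_const; apply: ler_prod => i _.
by rewrite e0 -lee_fin -eE; exact: mgf_row.
Qed.

(** Markov's inequality for the exponential; both signs of [l] are allowed and cover the two
    tails. *)
Lemma chernoff_sum l b : 4 * `|l| * M <= 2^-1 ->
  (P [set w | (b <= l * (\sum_i Z i w - 4 * N%:R))%R] <=
   (expR (32 * (l * M) ^+ 2 * N%:R - b))%:E)%E.
Proof.
move=> lM; pose S w := l * (\sum_i Z i w - 4 * N%:R).
have mS : measurable_fun setT S.
  by apply: measurable_funM => //; apply: measurable_funB => //; exact: measurable_sum.
have mES : measurable_fun setT (fun w => expR (S w)).
  exact: (measurableT_comp (@measurable_expR R)).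
have mA : measurable [set w | b <= S w].
  rewrite (_ : [set _ | _] = S @^-1` `[b, +oo[%classic).
    by apply: measurable_preimageT => //; exact: measurable_itv.
  by apply/seteqP; split => w /=; rewrite in_itv/= andbT.
rewrite -[X in P X]setIT -integral_indic//.
apply: (@le_trans _ _ (\int[P]_w ((expR (- b))%:E * (expR (S w))%:E))%E).
  apply: ge0_le_integral => //.
  - by apply/measurable_EFinP; exact: measurable_indic.
  - by apply: emeasurable_funM => //; exact/measurable_EFinP.
  - move=> w _; rewrite -EFinM lee_fin -expRD indicE.
    have [|_] := boolP (w \in _); last by rewrite expR_ge0.
    rewrite inE /= => bS.
    by rewrite -[leLHS]expR0 ler_expR addrC subr_ge0.
rewrite ge0_integralZl//=; last exact/measurable_EFinP.
rewrite addrC expRD EFinM lee_wpmul2l//; exact: mgf_sum.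
Qed.

(* The choice [l = min(dl, 1) / (64 M^2)] balances the two terms of the
   exponent, because [min(dl, 1) * max(dl, dl^2) = dl^2]. *)
Lemma quadratic_deviation dl : 0 < dl ->
  (P [set w | (Num.max dl (dl ^+ 2) * N%:R <= `|\sum_i Z i w - 4 * N%:R|)%R] <=
   (2 * expR (- (dl ^+ 2 * N%:R / (128 * M ^+ 2))))%:E)%E.
Proof.
move=> dl0; pose mn := Num.min dl 1; pose mx := Num.max dl (dl ^+ 2).
have M0 : 0 < M := lt_le_trans ltr01 M1.
have [mn0 mn1 mnd mnx] : [/\ 0 <= mn, mn <= 1, mn <= dl & mn * mx = dl ^+ 2].
  rewrite /mn /mx; have [d1|d1] := leP dl 1.
    rewrite max_l; last by rewrite expr2 ler_piMr// ltW.
    by split => //; exact: ltW.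
  rewrite max_r; last by rewrite expr2 ler_peMr// ltW.
  by rewrite mul1r; split => //; exact: ltW.
pose l := mn / (64 * M ^+ 2).
have l0 : 0 <= l by rewrite divr_ge0// mulr_ge0// exprn_ge0// ltW.
have lM : 4 * l * M <= 2^-1.
  have -> : 4 * l * M = mn / (16 * M) by rewrite /l; field; rewrite gt_eqF.
  by rewrite ler_pdivrMr ?mulr_gt0//; have := M1; lra.
(* The gain [l * (mx * N)] equals [dl^2 N / (64 M^2)], and the quadratic cost is at most half of
   it. *)
have bound : 32 * (l * M) ^+ 2 * N%:R - l * (mx * N%:R) <=
    - (dl ^+ 2 * N%:R / (128 * M ^+ 2)).
  have -> : l * (mx * N%:R) = dl ^+ 2 * N%:R / (64 * M ^+ 2).
    by rewrite -mnx /l; ring.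
  have -> : 32 * (l * M) ^+ 2 * N%:R = mn ^+ 2 * N%:R / (128 * M ^+ 2).
    by rewrite /l; field; rewrite gt_eqF.
  have : mn ^+ 2 * N%:R / (128 * M ^+ 2) <= dl ^+ 2 * N%:R / (128 * M ^+ 2).
    rewrite ler_wpM2r// ?invr_ge0 ?mulr_ge0 ?exprn_ge0 ?(ltW M0)//.
    by rewrite ler_wpM2r// lerXn2r// nnegrE ltW.
  have -> : dl ^+ 2 * N%:R / (64 * M ^+ 2) = 2 * (dl ^+ 2 * N%:R / (128 * M ^+ 2)).
    by field; rewrite gt_eqF.
  lra.
pose S w := \sum_i Z i w - 4 * N%:R.
have mS : measurable_fun setT S.
  by apply: measurable_funB => //; exact: measurable_sum.
have mA k : measurable [set w | l * (mx * N%:R) <= k * S w].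
  rewrite (_ : [set _ | _] = (fun w => k * S w) @^-1` `[l * (mx * N%:R), +oo[%classic).
    by apply: measurable_preimageT; [exact: measurable_funM|exact: measurable_itv].
  by apply/seteqP; split => w /=; rewrite in_itv/= andbT.
have lNM : 4 * `|- l| * M <= 2^-1 by rewrite normrN ger0_norm.
have lpM : 4 * `|l| * M <= 2^-1 by rewrite ger0_norm.
have c1 := chernoff_sum l (l * (mx * N%:R)) lpM.
have c2 := chernoff_sum (- l) (l * (mx * N%:R)) lNM.
apply: (@le_trans _ _ (P ([set w | l * (mx * N%:R) <= l * S w] `|`
    [set w | l * (mx * N%:R) <= - l * S w]))).
  apply: le_measure; rewrite ?inE.
  - rewrite (_ : [set _ | _] = (fun w => `|S w|) @^-1` `[mx * N%:R, +oo[%classic).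
      apply: measurable_preimageT; last exact: measurable_itv.
      exact: (measurableT_comp (@normr_measurable R setT)).
    by apply/seteqP; split => w /=; rewrite in_itv/= andbT.
  - exact: measurableU.
  - move=> w /=; rewrite -/(S w) -/mx => h.
    have [S0|S0] := leP 0 (S w).
      by left; rewrite ler_wpM2l// -(ger0_norm S0).
    by right; rewrite mulNr -mulrN ler_wpM2l// -(ltr0_norm S0).
apply: (le_trans (measureU2 _ (mA l) (mA (- l)))).
rewrite mulr_natl mulr2n EFinD; apply: leeD.
  by apply: le_trans c1 _; rewrite lee_fin ler_expR.
by apply: le_trans c2 _; rewrite lee_fin ler_expR mulNr sqrrN.
Qed.

End Deviation.

(** * Concentration of the singular values *)

Lemma measure_bigsetU_le {d} {T : measurableType d} {R : realType}
    (P : probability T R) {I : Type} (F : seq I) (B : I -> set T) :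
  (forall i, measurable (B i)) ->
  (P (\big[setU/set0]_(i <- F) B i) <= \sum_(i <- F) P (B i))%E.
Proof.
move=> mB; elim: F => [|i F IH]; first by rewrite !big_nil measure0.
rewrite !big_cons (le_trans (measureU2 _ _ _))//; last by rewrite leeD2l.
exact: bigsetU_measurable.
Qed.

Lemma qform_scalar {R : comPzRingType} {m} (a : R) (y : 'cV[R]_m) :
  qform a%:M y = a * dotv y y.
Proof. by rewrite /qform mul_scalar_mx dotvZr. Qed.

Lemma qformB {R : pzRingType} {m} (S S' : 'M[R]_m) y :
  qform (S - S') y = qform S y - qform S' y.
Proof. by rewrite /qform mulmxBl /dotv mulmxBr !mxE. Qed.

Section SingularValueEvent.
Context {R : realType} {N n : nat} (n0 : (0 < n)%N) (nN : (n <= N)%N).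
Implicit Types (A : 'M[quat R]_(N, n)) (a b : R).

Lemma gram_ge0 A y : 0 <= qform (gram A) y.
Proof.
by rewrite qform_gramE sumr_ge0// => i _; rewrite sumr_ge0// => c _; exact: sqr_ge0.
Qed.

(** [Num.max 0 b] guards the squaring: a negative [b] is a void lower bound, but [b ^+ 2] would not
    be. *)
Lemma sigma_boundsP A a b : 0 <= a ->
  [/\ b <= sigma_min A, sigma_min A <= sigma_max A & sigma_max A <= a] <->
  forall y, Num.max 0 b ^+ 2 * dotv y y <= qform (gram A) y <= a ^+ 2 * dotv y y.
Proof.
move=> a0; have /andP[min0 minmax] := sigma_min_le_max A n0 nN.
have b0 : 0 <= Num.max 0 b by rewrite le_max lexx.
split=> [[bmin _ maxa] y|bounds].
  have [x <-] := realvec_adjoint_surj y.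
  rewrite qform_gram dotv_realvec_adjoint; apply/andP; split.
    apply: (sigma_min_geP A _ n0 nN b0).2.
    by rewrite ge_max min0.
  exact: (sigma_max_leP A a n0 nN a0).2.
split => //.
  have : Num.max 0 b <= sigma_min A.
    apply: (sigma_min_geP A _ n0 nN b0).1 => x.
    by have /andP[+ _] := bounds (realvec (qadjoint x));
      rewrite qform_gram dotv_realvec_adjoint.
  by rewrite ge_max => /andP[].
apply: (sigma_max_leP A _ n0 nN a0).1 => x.
by have /andP[_] := bounds (realvec (qadjoint x));
  rewrite qform_gram dotv_realvec_adjoint.
Qed.

(** [qform_int_ge0] applies to [gram A - max(0, b)^2] and to [a^2 - gram A]; the conditions become
    countably many. *)
Lemma sigma_bounds_intP A a b : 0 <= a ->
  [/\ b <= sigma_min A, sigma_min A <= sigma_max A & sigma_max A <= a] <->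
  forall z : 'cV[int]_(n + n + (n + n)), let y := map_mx intr z in
    Num.max 0 b ^+ 2 * dotv y y <= qform (gram A) y <= a ^+ 2 * dotv y y.
Proof.
move=> a0; apply: (iff_trans (sigma_boundsP A a b a0)).
split => [h z|h y]; first exact: h.
have sym s : (gram A - s%:M)^T = gram A - s%:M.
  by rewrite linearB /= gram_sym tr_scalar_mx.
have sym' s : (s%:M - gram A)^T = s%:M - gram A.
  by rewrite linearB /= gram_sym tr_scalar_mx.
apply/andP; split.
  rewrite -subr_ge0 -qform_scalar -qformB; apply: qform_int_ge0 => // z.
  by rewrite qformB qform_scalar subr_ge0; have /andP[] := h z.
rewrite -subr_ge0 -qform_scalar -qformB; apply: qform_int_ge0 => // z.
by rewrite qformB qform_scalar subr_ge0; have /andP[] := h z.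
Qed.

(* [2 sqrt N (1 -+ dl)] squared compared with [4 N (1 -+ max(dl, dl^2))]. *)
Lemma sigma_bounds_of_net A dl (F : seq 'cV[int]_(n + n + (n + n))) :
  0 < dl ->
  (forall z : 'cV[int]_(n + n + (n + n)),
     (\sum_i `|z i ord0| <= 5 * (n + n + (n + n)))%N -> z \in F) ->
  (forall z, z \in F -> let y := map_mx intr z in
     `|qform (gram A) y - 4 * N%:R * dotv y y| <=
     Num.max dl (dl ^+ 2) * N%:R * dotv y y) ->
  [/\ 2 * Num.sqrt N%:R * (1 - dl) <= sigma_min A, sigma_min A <= sigma_max A
    & sigma_max A <= 2 * Num.sqrt N%:R * (1 + dl)].
Proof.
move=> dl0 Fnet FA; set mx := Num.max dl (dl ^+ 2) in FA.
have mx0 : 0 <= mx by rewrite le_max ltW.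
have N0 : 0 <= N%:R :> R by [].
pose D := gram A - (4 * N%:R)%:M.
have symD : D^T = D by rewrite linearB /= gram_sym tr_scalar_mx.
have netD y : `|qform D y| <= 4 * (mx * N%:R) * dotv y y.
  apply: (qform_net _ _ symD); first by rewrite mulr_ge0.
  by move=> z /Fnet/FA; rewrite qformB qform_scalar.
have sq : Num.sqrt N%:R ^+ 2 = N%:R :> R by rewrite sqr_sqrtr.
have s0 : 0 <= Num.sqrt N%:R :> R by exact: sqrtr_ge0.
apply/sigma_boundsP; first by rewrite !mulr_ge0// ltW// addr_gt0.
move=> y; have := netD y; rewrite qformB qform_scalar ler_norml => /andP[lo hi].
have Y0 := dotv_ge0 y.
apply/andP; split.
  have [b0|b0] := leP 0 (2 * Num.sqrt N%:R * (1 - dl)); last first.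
    by rewrite expr0n mul0r gram_ge0.
  have [N00|Npos] := eqVneq (N%:R : R) 0.
    by rewrite N00 sqrtr0 mulr0 mul0r expr0n mul0r gram_ge0.
  (* A nonnegative lower bound forces [dl <= 1]; there the maximum is [dl], and
     [(1 - dl)^2 <= 1 - dl]. *)
  have d1 : dl <= 1.
    move: b0; rewrite pmulr_rge0 ?subr_ge0//.
    by rewrite mulr_gt0// sqrtr_gt0 lt_neqAle eq_sym Npos.
  have mxd : mx = dl by rewrite /mx max_l// expr2 ler_piMr// ltW.
  apply: (@le_trans _ _ ((4 * N%:R - 4 * (mx * N%:R)) * dotv y y)); last by lra.
  apply: ler_wpM2r => //; rewrite 2!exprMn sq mxd.
  have : 0 <= N%:R * (dl * (1 - dl)) :> R.
    by rewrite mulr_ge0// mulr_ge0 ?subr_ge0// ltW.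
  by lra.
apply: (@le_trans _ _ ((4 * N%:R + 4 * (mx * N%:R)) * dotv y y)); first by lra.
apply: ler_wpM2r => //; rewrite 2!exprMn sq.
(* [1 + max(dl, dl^2) <= 1 + dl + dl^2 <= (1 + dl)^2]. *)
have : N%:R * mx <= N%:R * (dl + dl ^+ 2) :> R.
  by apply: ler_wpM2l => //; rewrite ge_max lerDl lerDr sqr_ge0 ltW.
have : 0 <= N%:R * dl :> R by rewrite mulr_ge0// ltW.
by lra.
Qed.

End SingularValueEvent.

(** * Measurability of the events *)

Lemma measurable_realvec_row {d} {T : measurableType d} {R : realType} {N n : nat}
    (A : T -> 'M[quat R]_(N, n)) i k : random_qmatrix A ->
  measurable_fun setT (fun w => realvec (row i (A w)) k ord0).
Proof.
move=> mA.
case: (split_ordP k) => k' ->; case: (split_ordP k') => j ->;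
  have [mw mx my mz] := mA i j.
- by under eq_fun do rewrite /realvec 2!col_mxEu !mxE.
- by under eq_fun do rewrite /realvec col_mxEu col_mxEd !mxE.
- by under eq_fun do rewrite /realvec col_mxEd col_mxEu !mxE.
- by under eq_fun do rewrite /realvec 2!col_mxEd !mxE.
Qed.

(** The quaternion factor sits on the deterministic vector, so every square tests the row itself, to
    which the moment and independence hypotheses refer. *)
Lemma qform_gram_rows {R : realType} {N n : nat} (A : 'M[quat R]_(N, n)) x :
  qform (gram A) (realvec (qadjoint x)) = \sum_i \sum_c
    dotv (realvec (row i A)) (realvec (qadjoint (x *m (qbasis R c)%:M))) ^+ 2.
Proof.
rewrite qform_gramE; apply: eq_bigr => i _; apply: eq_bigr => c _.
by rewrite dotv_realvecZ.
Qed.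

Lemma measurable_qform_gram {d} {T : measurableType d} {R : realType} {N n : nat}
    (A : T -> 'M[quat R]_(N, n)) y : random_qmatrix A ->
  measurable_fun setT (fun w => qform (gram (A w)) y).
Proof.
move=> mA; have [x <-] := realvec_adjoint_surj y.
under eq_fun do rewrite qform_gram_rows.
apply: measurable_sum => i; apply: measurable_sum => c; apply: measurable_funX.
by apply: measurable_dotv => k; exact: measurable_realvec_row.
Qed.

Lemma measurable_sigma_bounds {d} {T : measurableType d} {R : realType}
    {N n : nat} (A : T -> 'M[quat R]_(N, n)) (a b : R) :
  (0 < n)%N -> (n <= N)%N -> 0 <= a -> random_qmatrix A ->
  measurable [set w | [/\ b <= sigma_min (A w), sigma_min (A w) <= sigma_max (A w)
                        & sigma_max (A w) <= a]].
Proof.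
move=> n0 nN a0 mA.
pose E (z : 'cV[int]_(n + n + (n + n))) := let y := map_mx intr z in
  [set w | Num.max 0 b ^+ 2 * dotv y y <= qform (gram (A w)) y <= a ^+ 2 * dotv y y].
have mE z : measurable (E z).
  rewrite (_ : E z = (fun w => qform (gram (A w)) (map_mx intr z)) @^-1`
    `[Num.max 0 b ^+ 2 * dotv (map_mx intr z) (map_mx intr z),
      a ^+ 2 * dotv (map_mx intr z) (map_mx intr z)]%classic).
    by apply: measurable_preimageT; [exact: measurable_qform_gram|exact: measurable_itv].
  by apply/seteqP; split => w /=; rewrite in_itv.
rewrite (_ : [set w | _] = ~` \bigcup_z ~` E z).
  apply: measurableC; apply: countable_bigcupT_measurable; first exact: countableP.
  by move=> z; exact: measurableC.
rewrite setC_bigcup; apply/seteqP; split => w /=.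
  by move=> /(sigma_bounds_intP n0 nN (A w) a b a0) h z _; rewrite setCK; exact: h.
by move=> h; apply/(sigma_bounds_intP n0 nN (A w) a b a0) => z; have := h z I;
  rewrite setCK.
Qed.

(** * Deviation of the Gram form at one vector *)

Section RandomMatrix.
Context {R : realType} {N n : nat} {d : measure_display} {T : measurableType d}.
Context (P : probability T R) (A : T -> 'M[quat R]_(N, n)) (K : R).
Context (K0 : 0 < K) (n0 : (0 < n)%N) (nN : (4 * n < N)%N).
Context (mA : random_qmatrix A) (indA : independent_rows P A).
Context (isoA : forall i : 'I_N, isotropic P (fun w => row i (A w))).
Context (KA :
  \big[maxe/-oo%E]_(i < N) psi2_norm_qvec P (fun w => row i (A w)) = K%:E).

Let V i w := realvec (row i (A w)).
Let M := 2 * expR 1 * K ^+ 2.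

Let mV i k : measurable_fun setT (fun w => V i w k ord0).
Proof. exact: measurable_realvec_row. Qed.

Lemma row_moment i u p : dotv u u = 1 ->
  (\int[P]_w (dotv (V i w) u ^+ (2 * p))%:E <= (M ^+ p * p`!%:R)%:E)%E.
Proof.
move=> u1; apply: psi2_norm_moment => //.
apply: (@le_trans _ _ (psi2_norm_qvec P (fun w => row i (A w)))).
  by apply: ereal_sup_ubound; exists u.
by rewrite -KA; exact: le_bigmax.
Qed.

Lemma row_second_moment i u : dotv u u = 1 ->
  (\int[P]_w (dotv (V i w) u ^+ 2)%:E = 1)%E.
Proof. by move=> u1; apply: isotropic_second_moment => //; exact: isoA. Qed.

(** The moment bound at [p = 1] meets the exact second moment 1, so [K] cannot be arbitrarily
    small. *)
Let M1 : 1 <= M.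
Proof.
have N0 : (0 < N)%N by apply: leq_ltn_trans nN.
pose e : 'cV[quat R]_n := delta_mx (Ordinal n0) ord0.
have u1 : dotv (realvec (qadjoint e)) (realvec (qadjoint e)) = 1.
  by rewrite dotv_realvec_adjoint cnorm2_delta.
have := row_moment (Ordinal N0) _ 1 u1.
by rewrite (row_second_moment (Ordinal N0) _ u1) expr1 mulr1 lee_fin.
Qed.

(** Both sides of the inequality are homogeneous of degree 2 in [y], which may thus be scaled to
    length 1; the vectors [u c] then also have length 1, because right multiplication by a unit
    quaternion preserves it. *)
Lemma gram_deviation dl y : 0 < dl ->
  (P [set w | (Num.max dl (dl ^+ 2) * N%:R * dotv y y <
               `|qform (gram (A w)) y - 4 * N%:R * dotv y y|)%R] <=
   (2 * expR (- (dl ^+ 2 * N%:R / (128 * M ^+ 2))))%:E)%E.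
Proof.
move=> dl0; have [->|y0] := eqVneq y 0.
  (* At [y = 0] the strict inequality makes the event empty. *)
  rewrite [X in P X](_ : _ = set0); first by rewrite measure0 lee_fin mulr_ge0// expR_ge0.
  apply/seteqP; split => // w /=.
  have -> : dotv (0 : 'cV[R]_(n + n + (n + n))) 0 = 0 by apply/eqP; rewrite dotv_eq0.
  by rewrite /qform mulmx0 /dotv mulmx0 mxE !mulr0 subrr normr0 ltxx.
have Y0 : 0 < dotv y y by rewrite lt_neqAle eq_sym dotv_eq0 y0 dotv_ge0.
pose a := (Num.sqrt (dotv y y))^-1.
have a2 : a ^+ 2 * dotv y y = 1.
  by rewrite exprVn sqr_sqrtr ?ltW// mulVf// gt_eqF.
have a0 : 0 < a ^+ 2 by rewrite exprn_gt0// invr_gt0 sqrtr_gt0.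
have [x xE] := realvec_adjoint_surj (a *: y).
pose u c := realvec (qadjoint (x *m (qbasis R c)%:M)).
have u1 c : dotv (u c) (u c) = 1.
  rewrite dotv_realvec_adjoint cnorm2Zr qnorm2_basis mulr1 -dotv_realvec_adjoint xE.
  by rewrite dotvZl dotvZr mulrA -expr2 a2.
have V2 i c := row_second_moment i (u c) (u1 c).
have Vp i c p := row_moment i (u c) p (u1 c).
have := quadratic_deviation P V u M mV indA V2 Vp M1 dl dl0.
pose q w := qform (gram (A w)) y.
have mq : measurable_fun setT q by exact: measurable_qform_gram.
have qE w : \sum_i \sum_c dotv (V i w) (u c) ^+ 2 = a ^+ 2 * q w.
  by rewrite /q -qformZ -xE qform_gram_rows.
have abs_meas (k b : R) : measurable [set w | b < `|q w - k|].
  rewrite (_ : [set _ | _] = (fun w => `|q w - k|) @^-1` `]b, +oo[%classic).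
    apply: measurable_preimageT; last exact: measurable_itv.
    apply: (measurableT_comp (@normr_measurable R setT)).
    exact: measurable_funB.
  by apply/seteqP; split => w /=; rewrite in_itv/= andbT.
set mx := Num.max _ _.
have scaled w : `|\sum_i \sum_c dotv (V i w) (u c) ^+ 2 - 4 * N%:R| =
    a ^+ 2 * `|q w - 4 * N%:R * dotv y y|.
  rewrite qE -[X in X * `|_|](gtr0_norm a0) -normrM mulrBr (mulrCA _ _ (dotv y y)).
  by rewrite a2 mulr1.
have scaled_le w b : (b <= `|\sum_i \sum_c dotv (V i w) (u c) ^+ 2 - 4 * N%:R|) =
    (b * dotv y y <= `|q w - 4 * N%:R * dotv y y|).
  rewrite scaled -(ler_pM2l a0 (b * dotv y y)) mulrCA a2 mulr1//.
apply: le_trans; apply: le_measure; rewrite ?inE.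
- exact: abs_meas.
- rewrite (_ : [set _ | _] = (fun w => `|q w - 4 * N%:R * dotv y y|) @^-1`
    `[mx * N%:R * dotv y y, +oo[%classic).
    apply: measurable_preimageT; last exact: measurable_itv.
    apply: (measurableT_comp (@normr_measurable R setT)).
    exact: measurable_funB.
  by apply/seteqP; split => w /=; rewrite in_itv/= andbT scaled_le.
- by move=> w /= /ltW; rewrite scaled_le.
Qed.

End RandomMatrix.

(* The factor 29 comes from [2 * 2 ^ (28 n) <= exp (29 n)]. *)
Lemma net_count_expR {R : realType} (n k : nat) (x y : R) : (0 < n)%N ->
  (k <= 2 ^ (7 * (n + n + (n + n))))%N -> 29 * n%:R + y <= x ->
  k%:R * (2 * expR (- x)) <= expR (- y).
Proof.
move=> n0 kn xy; have e2 : 2 <= expR 1 :> R by have := @expR_ge1Dx R 1; lra.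
apply: (@le_trans _ _ (2 ^+ (29 * n) * expR (- x))).
  rewrite mulrA ler_wpM2r ?expR_ge0//.
  apply: (@le_trans _ _ (2 ^+ (7 * (n + n + (n + n))) * 2)).
    by rewrite ler_wpM2r// -natrX ler_nat.
  by rewrite -exprSr ler_weXn2l ?ler1n//; lia.
apply: (@le_trans _ _ (expR 1 ^+ (29 * n) * expR (- x))).
  by rewrite ler_wpM2r ?expR_ge0// lerXn2r ?nnegrE ?expR_ge0.
rewrite -expRM_natl mulr1 -expRD ler_expR natrM; lra.
Qed.

Theorem theorem4p6 (R : realType) :
  exists c : R, 0 < c /\
  forall K : R, 0 < K ->
  exists C : R, 0 < C /\
  forall (N n : nat) (d : measure_display) (T : measurableType d)
         (P : probability T R) (A : T -> 'M[quat R]_(N, n)),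
    (0 < n)%N -> (4 * n < N)%N ->
    random_qmatrix A ->
    independent_rows P A ->
    (forall i : 'I_N, subgaussian_qvec P (fun w => row i (A w))) ->
    (forall i : 'I_N, isotropic P (fun w => row i (A w))) ->
    \big[maxe/-oo%E]_(i < N) psi2_norm_qvec P (fun w => row i (A w)) = K%:E ->
    forall t : R, 0 < t ->
      ((1 - expR (- (c * t ^+ 2 / K ^+ 4)))%:E <=
       P [set w |
           ([/\ 2 * Num.sqrt N%:R - 2 * C * Num.sqrt n%:R - 2 * t
                 <= sigma_min (A w),
               sigma_min (A w) <= sigma_max (A w) &
               sigma_max (A w)
                 <= 2 * Num.sqrt N%:R + 2 * C * Num.sqrt n%:R + 2 * t])%R])%E.
Proof.
have e0 : 0 < expR 1 :> R := expR_gt0 1.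
(* With [M = 2 e K^2] one has [128 M^2 = 512 e^2 K^4], so that [c / K ^+ 4] is [1 / (128 M^2)]. *)
pose c : R := (512 * expR 1 ^+ 2)^-1.
have c0 : 0 < c.
  by rewrite invr_gt0; apply: mulr_gt0; [rewrite ltr0n|exact: exprn_gt0].
exists c; split => //.
move=> K K0; pose kap := c / K ^+ 4.
have kap0 : 0 < kap := divr_gt0 c0 (exprn_gt0 4 K0).
(* [kap * C = 29 + kap] and [1 <= C] give [29 <= kap * C ^+ 2], enough to pay for the net. *)
pose C := 29 / kap + 1.
have C1 : 1 <= C by rewrite lerDr divr_ge0// ltW.
have kC : 29 <= kap * C ^+ 2.
  have -> : kap * C ^+ 2 = C * (29 + kap) by rewrite /C; field; rewrite gt_eqF.
  by nra.
exists C; split; first exact: lt_le_trans C1.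
move=> N n d T P A n0 nN mA indA _ isoA KA t t0.
have N0 : 0 < N%:R :> R by rewrite ltr0n (leq_ltn_trans _ nN).
have sN0 : 0 < Num.sqrt N%:R :> R by rewrite sqrtr_gt0.
have sN2 : Num.sqrt N%:R ^+ 2 = N%:R :> R by rewrite sqr_sqrtr// ltW.
have sn0 : 0 <= Num.sqrt n%:R :> R by exact: sqrtr_ge0.
have sn2 : Num.sqrt n%:R ^+ 2 = n%:R :> R by rewrite sqr_sqrtr.
have C0 : 0 <= C by rewrite (le_trans ler01).
have Cn0 : 0 <= C * Num.sqrt n%:R by rewrite mulr_ge0.
(* Makes [2 sqrt N (1 - dl)] and [2 sqrt N (1 + dl)] the two bounds to be proved. *)
pose dl := (C * Num.sqrt n%:R + t) / Num.sqrt N%:R.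
have dl0 : 0 < dl by rewrite divr_gt0// ltr_wpDl.
have dlN : dl * Num.sqrt N%:R = C * Num.sqrt n%:R + t by rewrite divfK// gt_eqF.
have nN' : (n <= N)%N by rewrite (leq_trans _ (ltnW nN))// leq_pmull.
have [F [sizeF netF]] := small_int_vectors (n + n + (n + n)).
pose B (z : 'cV[int]_(n + n + (n + n))) := let y := map_mx intr z in
  [set w | Num.max dl (dl ^+ 2) * N%:R * dotv y y <
           `|qform (gram (A w)) y - 4 * N%:R * dotv y y|].
have mB z : measurable (B z).
  pose y : 'cV[R]_(n + n + (n + n)) := map_mx intr z.
  rewrite (_ : B z = (fun w => `|qform (gram (A w)) y - 4 * N%:R * dotv y y|) @^-1`
    `]Num.max dl (dl ^+ 2) * N%:R * dotv y y, +oo[%classic).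
    apply: measurable_preimageT; last exact: measurable_itv.
    apply: (measurableT_comp (@normr_measurable R setT)).
    by apply: measurable_funB => //; exact: measurable_qform_gram.
  by apply/seteqP; split => w /=; rewrite in_itv/= andbT.
pose a := 2 * Num.sqrt N%:R + 2 * C * Num.sqrt n%:R + 2 * t.
pose b := 2 * Num.sqrt N%:R - 2 * C * Num.sqrt n%:R - 2 * t.
pose E := [set w | [/\ b <= sigma_min (A w), sigma_min (A w) <= sigma_max (A w)
                     & sigma_max (A w) <= a]].
have a0 : 0 <= a by rewrite /a; lra.
have mE : measurable E by exact: measurable_sigma_bounds.
have EB : ~` E `<=` \big[setU/set0]_(z <- F) B z.
  move=> w; apply: contra_notP; rewrite -bigcup_seq /E /= => nB.
  have -> : b = 2 * Num.sqrt N%:R * (1 - dl) by rewrite /b; lra.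
  have -> : a = 2 * Num.sqrt N%:R * (1 + dl) by rewrite /a; lra.
  apply: (sigma_bounds_of_net n0 nN' (A w) dl F) => // z zF /=.
  by rewrite leNgt; apply/negP => Bz; apply: nB; exists z.
have PB z : (P (B z) <= (2 * expR (- (kap * (dl ^+ 2 * N%:R))))%:E)%E.
  have -> : kap * (dl ^+ 2 * N%:R) =
      dl ^+ 2 * N%:R / (128 * (2 * expR 1 * K ^+ 2) ^+ 2).
    by rewrite /kap /c; field; rewrite !gt_eqF.
  exact: gram_deviation.
have PE : (P (~` E) <= (expR (- (c * t ^+ 2 / K ^+ 4)))%:E)%E.
  apply: (@le_trans _ _ (P (\big[setU/set0]_(z <- F) B z))).
    by apply: le_measure => //; rewrite inE; [exact: measurableC|exact: bigsetU_measurable].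
  apply: (le_trans (measure_bigsetU_le P F B mB)).
  apply: (@le_trans _ _ (\sum_(z <- F) (2 * expR (- (kap * (dl ^+ 2 * N%:R))))%:E)%E).
    by apply: lee_sum => z _; exact: PB.
  rewrite sumEFin lee_fin big_const_seq count_predT iter_addr_0 -[_ *+ size F]mulr_natl.
  apply: (net_count_expR n) => //.
  have -> : dl ^+ 2 * N%:R = (C * Num.sqrt n%:R + t) ^+ 2.
    by rewrite -dlN [RHS]exprMn sN2.
  have -> : c * t ^+ 2 / K ^+ 4 = kap * t ^+ 2 by rewrite /kap mulrAC.
  (* In the expanded square [kap C^2 n] pays for the net, [kap t^2] is the desired exponent, and the
     cross term is nonnegative. *)
  have -> r : kap * (C * r + t) ^+ 2 =
    kap * C ^+ 2 * r ^+ 2 + 2 * (kap * (C * r * t)) + kap * t ^+ 2 by ring.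
  rewrite sn2.
  have : 29 * n%:R <= kap * C ^+ 2 * n%:R by rewrite ler_wpM2r.
  have : 0 <= kap * (C * Num.sqrt n%:R * t).
    exact: mulr_ge0 (ltW kap0) (mulr_ge0 Cn0 (ltW t0)).
  lra.
have := probability_setC P (measurableC mE); rewrite setCK => PEE.
by rewrite -[X in P X]/E PEE EFinB leeB.
Qed.
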